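(* (i) The set $\mathcal{K}=\{F\in\mathbf{WQSym}:\ \Phi_{a\to b,d}(F(\mathbb{A}))=0\}$ equals $\bigoplus_{n\ge1}\mathcal{K}_n$; its homogeneous component of degree $n$ has dimension equal to the number of set compositions of $\{1,\dots,n\}$ with an odd number of parts; and $\mathcal{K}$ is the smallest homogeneous two-sided ideal of $\mathbf{WQSym}$ containing $P_1$ whose homogeneous components are stable under the actions of the symmetric groups. (ii) The dimension of the degree-$n$ component of the image of $\Phi_{a\to b,d}$, that is of $(\mathrm{Sol}_{NC}')_n$, is the number of set compositions of $\{1,\dots,n\}$ with an even number of parts.
   Context: Stable noncommutative polynomials in $A=\{a_1,a_2,\dots\}$: $P=(P_n)$, $P_n\in\mathbb{C}\langle a_1,\dots,a_n\rangle$, bounded degree, $P_{n+1}(a_1,\dots,a_n,0)=P_n$. For a word $w$ over $\mathbb{Z}_{>0}$, $\mathbf{a}_w=a_{w_1}\cdots a_{w_k}$; a word is packed if whenever $j+1$ occurs, $j$ occurs; $\mathrm{pack}(w)$ replaces the smallest letter by $1$, the second smallest by $2$, etc. $\mathbf{WQSym}$ is the algebra spanned by $P_u=\sum_{\mathrm{pack}(w)=u}\mathbf{a}_w$ ($u$ packed); $\mathbf{WQSym}_n$ is its degree-$n$ part, and $P_1=\sum_i a_i$. $S_n$ acts on degree-$n$ noncommutative polynomials by permuting positions of letters: $(a_{i_1}\cdots a_{i_n})\cdot\sigma=a_{i_{\sigma(1)}}\cdots a_{i_{\sigma(n)}}$, extended linearly; this preserves $\mathbf{WQSym}_n$. $\mathcal{K}_n$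 is the span of $\{(F\,P_1)\cdot\sigma: F\in\mathbf{WQSym}_{n-1},\ \sigma\in S_n\}$. $F\mapsto F(\mathbb{A})$ is the linear map with $P_u(\mathbb{A})$ (for packed $u=u_1\cdots u_n$ with largest letter $r$) having $N$-th component $\sum_g\prod_{j\ \mathrm{odd}}(-1)^{|g^{-1}(j)|}a_{g(u_1)}\cdots a_{g(u_n)}$, over weakly increasing $g:\{1,\dots,r\}\to\{1,\dots,N\}$ with $|g^{-1}(j)|\le1$ for even $j$. $\mathrm{Sol}_{NC}'$ is the set of stable noncommutative polynomials $h=(h_m)$ in $b_1,\dots,b_m,d_1,\dots,d_m$ (with $h_{m+1}(b,0;d,0)=h_m$) satisfying, for all $m\ge1$, $1\le i\le m$: $h_m|_{d_i=0}=h_{m-1}(b_1,\dots,b_{i-1},b_i+b_{i+1},\dots,b_m;d_1,\dots,d_{i-1},d_{i+1},\dots,d_m)$ ($i<m$), $h_m|_{d_m=0}=h_{m-1}(b_1,\dots,b_{m-1};d_1,\dots,d_{m-1})$, $h_m|_{b_i=0}=h_{m-1}(b_1,\dots,b_{i-1},b_{i+1},\dots,b_m;d_1,\dots,d_{i-2},d_{i-1}+d_i,d_{i+1},\dots,d_m)$ ($i>1$), $h_m|_{b_1=0}=h_{m-1}(b_2,\dots,b_m;d_2,\dots,d_m)$; $(\mathrm{Sol}_{NC}')_n$ is its homogeneous degree-$n$ part. $\Phi_{a\to b,d}(P)=h$ with $h_m(b;d)=P_{2m+1}(a_1,\dots,a_{2m+1})$, $a_{2i+1}=(d_{i+1}+\dots+d_m)-(b_1+\dots+b_i)$,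 $a_{2i}=(d_i+\dots+d_m)-(b_1+\dots+b_i)$. A set composition of $\{1,\dots,n\}$ is an ordered list of pairwise disjoint nonempty subsets with union $\{1,\dots,n\}$. *)

(* Defs.v *)
From HB Require Import structures.
From mathcomp Require Import all_boot all_order all_algebra.
From mathcomp Require Import fingroup perm complex finmap monalg.
From mathcomp Require Import all_classical reals.

Set Implicit Arguments.
Unset Strict Implicit.
Unset Printing Implicit Defensive.

Import GRing.Theory.
Local Open Scope ring_scope.

Definition set_composition n (c : seq {set 'I_n}) : bool :=
  [&& finset.set0 \notin c,
      pairwise (fun A B : {set 'I_n} => [disjoint A & B]) c
    & [forall x : 'I_n, has (fun A : {set 'I_n} => x \in A) c]].

Lemma size_set_composition n (c : seq {set 'I_n}) :
  set_composition c -> (size c <= n)%N.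
Proof.
case/and3P=> c0 cP _.
pose U (c : seq {set 'I_n}) :=
  [pred x : 'I_n | has (fun A : {set 'I_n} => x \in A) c].
suff H : (size c <= #|U c|)%N.
  by rewrite -[leqRHS]card_ord; apply: leq_trans H (max_card _).
elim: c c0 cP => [|A c IH] //=; rewrite inE negb_or => /andP[A0 c0].
move=> /andP[Ac cP].
have -> : #|U (A :: c)| = #|[predU A & U c]| by apply: eq_card.
have cI : #|[predI A & U c]| = 0%N.
  apply: eq_card0 => x; apply/negbTE/negP => /andP[/= xA /hasP[B Bc xB]].
  by move/allP: Ac => /(_ B Bc)/pred0P/(_ x)/=; rewrite xA xB.
rewrite -[#|_|]addn0 -cI cardUI -add1n leq_add ?IH // card_gt0.
by rewrite eq_sym.
Qed.

(* By [size_set_composition], no set composition is lost by bounding the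
   length by n. *)
Definition num_set_compositions n (b : bool) : nat :=
  #|[pred c : n.-bseq {set 'I_n} | set_composition c & odd (size c) == b]|.

(* Letters are 1-based. *)
Definition packed : {pred seq nat} := fun u =>
  (0%N \notin u) && all (fun j => (1 < j)%N ==> (j.-1 \in u)) u.

Definition pack (w : seq nat) : seq nat :=
  [seq (index x (sort leq (undup w))).+1 | x <- w].

Definition maxletter (u : seq nat) : nat := \max_(x <- u) x.

(* The word u on the alphabet {1, ..., n}, the letter i being represented by
   the element of 'I_n of value i - 1; to be used for words with letters in
   {1, ..., n} only, since other letters are dropped or identified with 1. *)
Definition ord_word n (u : seq nat) : seq 'I_n := pmap insub (map predn u).

Lemma maxletter_mem u : u != [::] -> maxletter u \in u.
Proof.
rewrite /maxletter; elim: u => // x [|y u] IH _.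
  by rewrite big_seq1 inE.
rewrite big_cons inE /maxn; case: ifP => _; first by rewrite IH ?orbT.
by rewrite eqxx.
Qed.

Lemma mem_packed u x : packed u -> (x \in u) = (1 <= x <= maxletter u)%N.
Proof.
case/andP=> u0 /allP uP; apply/idP/andP => [xu|[x1 xr]].
  split; first by rewrite lt0n; apply: contraNneq u0 => <-.
  exact: (@leq_bigmax_seq _ u xpredT id x xu).
have u_neq0 : u != [::].
  by apply: contraTneq (leq_trans x1 xr) => ->; rewrite /maxletter big_nil.
have H k : (k < maxletter u)%N -> (maxletter u - k)%N \in u.
  elim: k => [_|k IH kr]; first by rewrite subn0 maxletter_mem.
  rewrite subnS; apply: (implyP (uP _ (IH (ltnW kr)))).
  by rewrite ltn_subRL addn1.
by rewrite -(subKn xr) H // ltn_subrL x1 (leq_trans x1 xr).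
Qed.

Lemma pack_packed u : packed u -> pack (map predn u) = u.
Proof.
move=> pu; rewrite /pack.
have -> : sort leq (undup (map predn u)) = iota 0 (maxletter u).
  apply: (sorted_eq leq_trans anti_leq).
  - by apply: sort_sorted; apply: leq_total.
  - exact: iota_sorted.
  rewrite perm_sort; apply: uniq_perm; rewrite ?undup_uniq ?iota_uniq //.
  move=> x; rewrite mem_undup mem_iota add0n /=.
  apply/mapP/idP => [[y yu ->]|xr].
    by move: yu; rewrite mem_packed // => /andP[y1]; case: y y1.
  by exists x.+1 => //; rewrite mem_packed.
rewrite -map_comp -[RHS]map_id; apply/eq_in_map => x /=.
rewrite mem_packed // => /andP[x1 xr].
have xr' : (x.-1 < size (iota 0 (maxletter u)))%N.
  by rewrite size_iota prednK.
have {1}-> : x.-1 = nth 0%N (iota 0 (maxletter u)) x.-1.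
  by rewrite nth_iota ?prednK.
by rewrite index_uniq ?iota_uniq // prednK.
Qed.

Lemma val_ord_word u :
  packed u -> [seq val x | x <- ord_word (maxletter u) u] = map predn u.
Proof.
move=> pu; rewrite /ord_word (pmap_filter (@insubK _ _ _)).
apply/all_filterP/allP => _ /mapP[x xu ->].
rewrite isSome_insub; move: xu; rewrite mem_packed //.
by case: x.
Qed.

Local Open Scope classical_set_scope.

Section LinearAlgebra.
Variables (K : fieldType) (V : lmodType K).

Definition lin_span (S : set V) : set V :=
  [set v | exists n (c : 'I_n -> K) (x : 'I_n -> V),
     (forall i, S (x i)) /\ v = \sum_i c i *: x i].

Definition lin_indep d (e : 'I_d -> V) : Prop :=
  forall c : 'I_d -> K, \sum_i c i *: e i = 0 -> forall i, c i = 0.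

Definition has_dim (W : set V) (d : nat) : Prop :=
  exists e : 'I_d -> V, lin_indep e /\ W = lin_span (range e).

(* W is the internal direct sum of the subspaces U 1, U 2, ... *)
Definition direct_sum (W : set V) (U : nat -> set V) : Prop :=
  W = [set v | exists N (u : nat -> V),
         (forall n, (1 <= n < N)%N -> U n (u n)) /\
         v = \sum_(1 <= n < N) u n] /\
  (forall N (u : nat -> V), (forall n, (1 <= n < N)%N -> U n (u n)) ->
     \sum_(1 <= n < N) u n = 0 -> forall n, (1 <= n < N)%N -> u n = 0).

End LinearAlgebra.

(* K<I>: the algebra of the free monoid on I. *)
Definition ncpoly (K : fieldType) (I : choiceType) := {malg K[{fmonom I}]}.
HB.instance Definition _ K I := GRing.Lalgebra.on (ncpoly K I).

Section NcPoly.
Variable K : fieldType.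

Definition ncword (I : choiceType) (w : seq I) : ncpoly K I := << FMonom w >>.

Definition ncvar (I : choiceType) (i : I) : ncpoly K I := ncword [:: i].

Definition nccoef (I : choiceType) (p : ncpoly K I) (w : seq I) : K :=
  p@_(FMonom w).

Definition ncsubst (I J : choiceType) (v : I -> ncpoly K J) (p : ncpoly K I) :
    ncpoly K J :=
  \sum_(w <- msupp p) p@_w *: \prod_(x <- w : seq I) v x.

End NcPoly.

Definition ncseq (K : fieldType) (I : nat -> choiceType) :=
  forall n, ncpoly K (I n).

Section NcSeqAlgebra.
Variables (K : fieldType) (I : nat -> choiceType).
Implicit Types (F G H : ncseq K I).

HB.instance Definition _ := Choice.on (ncseq K I).

Definition ncseq_add F G : ncseq K I := fun n => F n + G n.
Definition ncseq_opp F : ncseq K I := fun n => - F n.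
Definition ncseq_zero : ncseq K I := fun=> 0.
Definition ncseq_mul F G : ncseq K I := fun n => F n * G n.
Definition ncseq_one : ncseq K I := fun=> 1.
Definition ncseq_scale (c : K) F : ncseq K I := fun n => c *: F n.

Fact ncseq_addA : associative ncseq_add.
Proof. by move=> F G H; apply: functional_extensionality_dep => n; apply: addrA. Qed.
Fact ncseq_addC : commutative ncseq_add.
Proof. by move=> F G; apply: functional_extensionality_dep => n; apply: addrC. Qed.
Fact ncseq_add0 : left_id ncseq_zero ncseq_add.
Proof. by move=> F; apply: functional_extensionality_dep => n; apply: add0r. Qed.
Fact ncseq_addN : left_inverse ncseq_zero ncseq_opp ncseq_add.
Proof. by move=> F; apply: functional_extensionality_dep => n; apply: addNr. Qed.

HB.instance Definition _ := GRing.isZmodule.Build (ncseq K I)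
  ncseq_addA ncseq_addC ncseq_add0 ncseq_addN.

Fact ncseq_mulA : associative ncseq_mul.
Proof. by move=> F G H; apply: functional_extensionality_dep => n; apply: mulrA. Qed.
Fact ncseq_mul1 : left_id ncseq_one ncseq_mul.
Proof. by move=> F; apply: functional_extensionality_dep => n; apply: mul1r. Qed.
Fact ncseq_1mul : right_id ncseq_one ncseq_mul.
Proof. by move=> F; apply: functional_extensionality_dep => n; apply: mulr1. Qed.
Fact ncseq_mulDl : left_distributive ncseq_mul ncseq_add.
Proof. by move=> F G H; apply: functional_extensionality_dep => n; apply: mulrDl. Qed.
Fact ncseq_mulDr : right_distributive ncseq_mul ncseq_add.
Proof. by move=> F G H; apply: functional_extensionality_dep => n; apply: mulrDr. Qed.
Fact ncseq_1neq0 : ncseq_one != ncseq_zero.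
Proof.
by apply/eqP => /(congr1 (fun F => F 0%N)); apply/eqP; rewrite oner_neq0.
Qed.

HB.instance Definition _ := GRing.Zmodule_isNzRing.Build (ncseq K I)
  ncseq_mulA ncseq_mul1 ncseq_1mul ncseq_mulDl ncseq_mulDr ncseq_1neq0.

Fact ncseq_scaleA c d F :
  ncseq_scale c (ncseq_scale d F) = ncseq_scale (c * d) F.
Proof. by apply: functional_extensionality_dep => n; apply: scalerA. Qed.
Fact ncseq_scale1 : left_id 1 ncseq_scale.
Proof. by move=> F; apply: functional_extensionality_dep => n; apply: scale1r. Qed.
Fact ncseq_scaleDr : right_distributive ncseq_scale +%R.
Proof. by move=> c F G; apply: functional_extensionality_dep => n; apply: scalerDr. Qed.
Fact ncseq_scaleDl F : {morph ncseq_scale^~ F : c d / c + d}.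
Proof. by move=> c d; apply: functional_extensionality_dep => n; apply: scalerDl. Qed.

HB.instance Definition _ := GRing.Zmodule_isLmodule.Build K (ncseq K I)
  ncseq_scaleA ncseq_scale1 ncseq_scaleDr ncseq_scaleDl.

Fact ncseq_scaleAl (c : K) F G : c *: (F * G) = (c *: F) * G.
Proof. by apply: functional_extensionality_dep => n; apply: scalerAl. Qed.

HB.instance Definition _ :=
  GRing.Lmodule_isLalgebra.Build K (ncseq K I) ncseq_scaleAl.

End NcSeqAlgebra.

Section Graded.
Variable K : fieldType.

(* r n is the substitution that discards the last variable(s) of I n.+1. *)
Definition stable (I : nat -> choiceType)
    (r : forall n, I n.+1 -> ncpoly K (I n)) (F : ncseq K I) : Prop :=
  (exists D, forall n (w : {fmonom (I n)}), w \in msupp (F n) -> (size w <= D)%N) /\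
  (forall n, ncsubst (r n) (F n.+1) = F n).

Definition homog (I : nat -> choiceType) (d : nat) : set (ncseq K I) :=
  [set F | forall n (w : {fmonom (I n)}), w \in msupp (F n) -> size w = d].

Definition homog_comp (I : nat -> finType) (d : nat) (F : ncseq K I) :
    ncseq K I :=
  fun n => \sum_(w : d.-tuple (I n)) nccoef (F n) w *: ncword K w.

(* Right action of the symmetric group on the positions of the letters; only
   meaningful on [homog n], terms of degree other than n being dropped. *)
Definition pos_act (I : nat -> finType) n (F : ncseq K I) (s : 'S_n) :
    ncseq K I :=
  fun N => \sum_(w : n.-tuple (I N))
    nccoef (F N) w *: ncword K [tuple tnth w (s i) | i < n].

End Graded.

Definition a_alph (n : nat) : finType := 'I_n.

Section WQSym.
Variable K : fieldType.
Notation polA := (ncseq K a_alph).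

Definition WQ_P (u : seq nat) : polA := fun n =>
  \sum_(w : (size u).-tuple 'I_n | pack [seq val x | x <- w] == u) ncword K w.

Definition WQSym : set polA := lin_span (WQ_P @` [set u | packed u]).

(* Coefficient of WQ_P u in an element of WQSym, see [WQ_coefP]: the word u
   first appears in the component indexed by its largest letter. *)
Definition WQ_coef (F : polA) (u : seq nat) : K :=
  nccoef (F (maxletter u)) (ord_word (maxletter u) u).

(* P_u(A). An ordinal j : 'I_N stands for the letter j.+1, whence the parities. *)
Definition WQ_PA (u : seq nat) : polA := fun N =>
  let r := maxletter u in
  \sum_(g : {ffun 'I_r -> 'I_N} |
          [forall i : 'I_r, forall k : 'I_r, (i <= k)%N ==> (g i <= g k)%N] &&
          [forall j : 'I_N, ~~ odd j.+1 ==> (#|[pred i | g i == j]| <= 1)%N])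
    (\prod_(j < N | odd j.+1) (-1) ^+ #|[pred i | g i == j]|) *:
      ncword K (map g (ord_word r u)).

(* F(A); the sum is finite on WQSym, see [evalA_P] and [evalA_lin]. *)
Definition evalA (F : polA) : polA := fun N =>
  \sum_(u \in [set u : seq nat | packed u]) WQ_coef F u *: WQ_PA u N.

Lemma WQ_coefP (u v : seq nat) :
  packed u -> WQ_coef (WQ_P v) u = (u == v)%:R.
Proof.
move=> pu; rewrite /WQ_coef /WQ_P /nccoef /ncword.
set r := maxletter u; have vu := val_ord_word pu; rewrite -/r in vu.
have su : size (ord_word r u) = size u by rewrite -(size_map val) vu size_map.
rewrite raddf_sum /=.
have eqw (w : (size v).-tuple 'I_r) :
    (FMonom w == FMonom (ord_word r u)) = (tval w == ord_word r u) by [].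
have [uv|uv] := eqVneq u v.
  subst v; move/eqP: su => su.
  rewrite (bigD1 (Tuple su)) /=; last by rewrite vu pack_packed.
  rewrite mcoeffUU big1 ?addr0 // => w /andP[_ wu].
  by rewrite mcoeffU1 eqw; have /negbTE -> : tval w != ord_word r u.
rewrite big1 // => w /eqP pw; rewrite mcoeffU1 eqw.
case: eqP => // wE; case/eqP: uv.
by rewrite -pw wE vu pack_packed.
Qed.

Lemma WQ_coef_lin c F G u :
  WQ_coef (c *: F + G) u = c * WQ_coef F u + WQ_coef G u.
Proof. by rewrite /WQ_coef /nccoef mcoeffD mcoeffZ. Qed.

Lemma WQ_coef_fin F : WQSym F ->
  exists s : seq (seq nat), forall u, packed u -> u \notin s -> WQ_coef F u = 0.
Proof.
case=> n [c [x [xP ->]]].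
have [y yP] : exists y : 'I_n -> seq nat, forall i, WQ_P (y i) = x i.
  have /choice[y yP] : forall i, exists u, WQ_P u = x i.
    by move=> i; have [u _ <-] := xP i; exists u.
  by exists y.
exists (codom y) => u pu uy.
have H : forall s : seq 'I_n, WQ_coef (\sum_(i <- s) c i *: x i) u = 0.
  elim=> [|i s IH]; first by rewrite big_nil /WQ_coef /nccoef mcoeff0.
  rewrite big_cons WQ_coef_lin IH -yP WQ_coefP // addr0.
  case: eqP => [uE|]; last by rewrite mulr0.
  by move: uy; rewrite uE codom_f.
exact: H.
Qed.

Lemma evalA_P u : packed u -> evalA (WQ_P u) = WQ_PA u.
Proof.
move=> pu; apply: functional_extensionality_dep => N; rewrite /evalA.
rewrite (fsbigE [:: u]) //=.
- rewrite big_cons big_nil addr0 mem_set //=.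
  by rewrite WQ_coefP // eqxx scale1r.
- by move=> v /=; rewrite inE => /eqP ->.
- by move=> v pv; rewrite inE WQ_coefP // => /negbTE ->; rewrite scale0r.
Qed.

Lemma evalA_lin c F G : WQSym F -> WQSym G ->
  evalA (c *: F + G) = c *: evalA F + evalA G.
Proof.
move=> /WQ_coef_fin[sF HF] /WQ_coef_fin[sG HG].
apply: functional_extensionality_dep => N.
pose s := [seq u <- undup (sF ++ sG) | packed u].
have sE u : packed u -> u \notin s -> (u \notin sF) * (u \notin sG).
  move=> pu; rewrite mem_filter pu mem_undup mem_cat negb_or.
  by case/andP=> -> ->.
have us : uniq s by rewrite filter_uniq ?undup_uniq.
have ss : [set` s] `<=` [set u : seq nat | packed u].
  by move=> u /=; rewrite mem_filter => /andP[].
have eE H : (forall u, packed u -> u \notin s -> WQ_coef H u = 0) ->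
    evalA H N = \sum_(u <- s | u \in [set u : seq nat | packed u])
                  WQ_coef H u *: WQ_PA u N.
  move=> HH; rewrite /evalA (fsbigE s) // => u pu us'.
  by rewrite HH ?scale0r.
rewrite -[RHS]/(c *: evalA F N + evalA G N).
rewrite !eE.
- rewrite scaler_sumr -big_split /=; apply: eq_bigr => u _.
  by rewrite WQ_coef_lin scalerDl scalerA.
- by move=> u pu us'; rewrite HG // (sE u).
- by move=> u pu us'; rewrite HF // (sE u).
- by move=> u pu us'; rewrite WQ_coef_lin HF ?HG ?(sE u) // mulr0 addr0.
Qed.

(* K_n, only meaningful for n >= 1. *)
Definition Kcal_deg (n : nat) : set polA :=
  lin_span [set G | exists F (s : 'S_n),
    (WQSym `&` homog n.-1) F /\ G = pos_act (F * WQ_P [:: 1%N]) s].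

(* Homogeneous two-sided ideals of WQSym containing P_1 whose homogeneous
   components are stable under the symmetric groups. *)
Record WQ_sym_ideal (J : set polA) : Prop := {
  WQI_sub : J `<=` WQSym;
  WQI_0 : J 0;
  WQI_lin : forall c F G, J F -> J G -> J (c *: F + G);
  WQI_mull : forall F G, WQSym F -> J G -> J (F * G);
  WQI_mulr : forall F G, J F -> WQSym G -> J (F * G);
  WQI_homog : forall n F, J F -> J (homog_comp n F);
  WQI_P1 : J (WQ_P [:: 1%N]);
  WQI_act : forall n (s : 'S_n) F, J F -> homog n F -> J (pos_act F s)
}.

End WQSym.

Arguments WQSym K : clear implicits.
Arguments Kcal_deg K n : clear implicits.

(* inl j stands for b_(j+1) and inr j for d_(j+1). *)
Definition bd_alph (m : nat) : finType := ('I_m + 'I_m)%type.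

Section BD.
Variable K : fieldType.
Notation polA := (ncseq K a_alph).
Notation polBD := (ncseq K bd_alph).

Definition bvar m (j : 'I_m) : ncpoly K (bd_alph m) := ncvar K (inl j : bd_alph m).
Definition dvar m (j : 'I_m) : ncpoly K (bd_alph m) := ncvar K (inr j : bd_alph m).

(* The value of a_t in terms of b and d; t is 1-based. *)
Definition a_value m (t : nat) : ncpoly K (bd_alph m) :=
  let i := t./2 in
  \sum_(j < m | ((if odd t then i.+1 else i) <= j.+1)%N) dvar j
  - \sum_(j < m | (j.+1 <= i)%N) bvar j.

Definition Phi (F : polA) : polBD := fun m =>
  ncsubst (fun k : a_alph m.*2.+1 => a_value m k.+1) (F m.*2.+1).

Definition bd_restrict m (x : bd_alph m.+1) : ncpoly K (bd_alph m) :=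
  match x with
  | inl j => if unlift ord_max j is Some k then bvar k else 0
  | inr j => if unlift ord_max j is Some k then dvar k else 0
  end.

Definition kill_d m (i : 'I_m) (x : bd_alph m) : ncpoly K (bd_alph m) :=
  match x with inl j => bvar j | inr j => if j == i then 0 else dvar j end.

Definition kill_b m (i : 'I_m) (x : bd_alph m) : ncpoly K (bd_alph m) :=
  match x with inl j => if j == i then 0 else bvar j | inr j => dvar j end.

(* The arguments of h_(m-1) when d_i = 0. [lift i] enumerates the indices
   other than i; since [lift i j] is the successor of i when j = i, the slot
   j = i receives b_i + b_(i+1). If i is the last index no j equals i, and
   the b-arguments are b_1, ..., b_(m-1). *)
Definition merge_b m (i : 'I_m.+1) (x : bd_alph m) : ncpoly K (bd_alph m.+1) :=
  match x with
  | inl j => (if (j == i :> nat) then bvar i else 0) + bvar (lift i j)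
  | inr j => dvar (lift i j)
  end.

(* The arguments of h_(m-1) when b_i = 0: the slot j = i - 1, for which
   [lift i j] = j, receives d_(i-1) + d_i. If i is the first index there is
   no such slot. *)
Definition merge_d m (i : 'I_m.+1) (x : bd_alph m) : ncpoly K (bd_alph m.+1) :=
  match x with
  | inl j => bvar (lift i j)
  | inr j => dvar (lift i j) + (if (j.+1 == i :> nat) then dvar i else 0)
  end.

Definition SolNC' : set polBD :=
  [set h | stable bd_restrict h /\
     forall m (i : 'I_m.+1),
       ncsubst (kill_d i) (h m.+1) = ncsubst (merge_b i) (h m) /\
       ncsubst (kill_b i) (h m.+1) = ncsubst (merge_d i) (h m)].

Definition Kcal : set polA := [set F | WQSym K F /\ Phi (evalA F) = 0].

(* The image of F |-> Phi (F(A)): Phi takes values in SolNC' only on the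
   sequences F(A). *)
Definition Phi_image : set polBD := [set Phi (evalA F) | F in WQSym K].

End BD.

Arguments SolNC' K : clear implicits.
Arguments Kcal K : clear implicits.
Arguments Phi_image K : clear implicits.

(* Main.v *)
(* Work with coefficients: an element of WQSym of degree n is a function of the
   relative order of the n letters of a word, and the coefficient of a word x
   in P_u(A) is a sign counting the blocks of u sent to negative letters.

   A positive and a negative letter that are adjacent and equal cancel in
   P_u(A), by moving one extreme block of u from one letter to the other. This
   gives Phi(F(A)) in Sol_NC'. A solution is determined by its coefficients on
   words containing all of b_1, ..., b_m, d_1, ..., d_m; there are as many of
   those in degree n as set compositions with an even number of parts, which
   bounds the rank of F |-> Phi(F(A)) from above.

   For the other direction let rho(F)(Y) = F(Y - P_1(Y)), where the letter
   P_1(Y) is subtracted at the end of the alphabet Y. As P_1 vanishes there,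
   rho factors through Phi, kills K_n and is the identity modulo K_n; so it is
   an idempotent with kernel K_n. Its diagonal entry at P_u, for u with r
   letters, is the alternating sum of (-1)^(r-i) over the cuts 0 <= i <= r, so
   its trace, hence its rank, is the number of u with r even. Comparing with
   the upper bound identifies the kernel of F |-> Phi(F(A)) with K_n and its
   image with Sol_NC'. *)

Require Import Defs.
From mathcomp Require Import all_classical reals.
From mathcomp Require Import all_boot all_order all_algebra.
From mathcomp Require Import fingroup perm finmap monalg.
From mathcomp Require Import zify.

Set Implicit Arguments.
Unset Strict Implicit.
Unset Printing Implicit Defensive.

Import GRing.Theory Num.Theory.
Local Open Scope ring_scope.

(** * Signed refinements: the coefficients of P_u(A) *)

(** Neither [K_n] nor Sol_NC' comes with a basis: one is given by redundant generators, the other by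
    equations. The dimensions are therefore found indirectly: coordinates bound one rank from above,
    and the rank of rho is its trace, for which only diagonal entries are computed. Characteristic
    zero enters here, since a trace in the field is compared with a natural number; hence
    [numFieldType]. That rho vanishes on [K_n] is again a matter of cancellation. A generator of
    [K_n] ignores the letter at some position [p]. Appending y - y to the alphabet changes nothing,
    and lets negative positions be traded for positive ones until none is left; there [F(A)] is [F]
    itself, and the freedom at [p] can be used. The form of Phi is explained by differences: up to
    sign, b_1, d_1, b_2, d_2, ... are the differences of consecutive letters. Killing one of them
    makes two neighbours of opposite signs equal, so each equation of Sol_NC' is one instance of the
    cancellation. *)

Section SignedRefinements.
Variables (K : numFieldType) (n : nat).
Implicit Types (u x y : 'I_n -> nat).

Definition same_order u x := forall p q, (u p <= u q)%N = (x p <= x q)%N.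

(** The existence of a map [g] as in [WQ_PA] with [x = g o u], expressed without [g]. Such a [g] is
    determined by [u] and [x], so a word occurs at most once in P_u(A). *)
Definition refines u x :=
  [forall p, forall q, ((u p <= u q)%N ==> (x p <= x q)%N)
                       && ((x p == x q) && odd (x p) ==> (u p == u q))].

(* Letters are 0-based: the even values stand for a_1, a_3, ..., which enter
   the virtual alphabet negatively. *)
Definition refsign u x : K :=
  \prod_(l < n) (-1) ^+ [exists p, (u p == l) && ~~ odd (x p)].

Definition refcoef u x : K := if refines u x then refsign u x else 0.

Lemma refinesP u x :
  reflect (forall p q, ((u p <= u q)%N -> (x p <= x q)%N) /\
             (x p = x q -> odd (x p) -> u p = u q))
          (refines u x).
Proof.
apply: (iffP forallP) => [H p q|H p].
  have /forallP/(_ q)/andP[/implyP H1 /implyP H2] := H p.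
  by split=> // e o; apply/eqP/H2; rewrite e eqxx -e.
apply/forallP => q; have [H1 H2] := H p q.
apply/andP; split; first exact/implyP.
by apply/implyP => /andP[/eqP e o]; rewrite H2.
Qed.

Lemma refsign_ext u x y : (forall p, odd (x p) = odd (y p)) ->
  refsign u x = refsign u y.
Proof.
move=> H; apply: eq_bigr => l _; congr (_ ^+ nat_of_bool _).
by apply: eq_existsb => p; rewrite H.
Qed.

Lemma refcoef_ext u x y : same_order x y -> (forall p, odd (x p) = odd (y p)) ->
  refcoef u x = refcoef u y.
Proof.
move=> H Hodd; rewrite /refcoef (refsign_ext _ Hodd); congr (if _ then _ else _).
apply: eq_forallb => p; apply: eq_forallb => q.
by rewrite H Hodd !eqn_leq !H.
Qed.

Definition toggle u (e z l : nat) x p :=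
  if u p == l then (if x p == e then z else if x p == z then e else x p)
  else x p.

Lemma toggleK u e z l x : toggle u e z l (toggle u e z l x) =1 x.
Proof.
by move=> p; rewrite /toggle; case: (u p == l) => //; do !case: eqP => //; congruence.
Qed.

Section Toggle.
Variables (u : 'I_n -> nat) (e z l : nat).
Hypotheses (un : forall p, (u p < n)%N) (ez : (e < z)%N) (oez : odd e != odd z).

(** No letter of [x] lies strictly between [e] and [z], and among the blocks of [u] sent to these
    two letters, [l] is the one on the side of the positive letter: the least if [e] is positive,
    the greatest if [z] is. A positive letter holds at most one block, so moving [l] either empties
    it or fills it. *)
Definition togglable x :=
  [/\ forall p, (x p <= e)%N || (z <= x p)%N,
      exists p, u p = l /\ ((x p == e) || (x p == z)) &
      forall p, (x p == e) || (x p == z) ->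
        if odd e then (l <= u p)%N else (u p <= l)%N].

Lemma togglable_toggle x : togglable x -> togglable (toggle u e z l x).
Proof.
have H p : (toggle u e z l x p == e) || (toggle u e z l x p == z)
           = (x p == e) || (x p == z).
  by rewrite /toggle; case: (u p == l) => //; do !case: eqP => //; congruence.
case=> H1 [p [up xp]] H3; split.
- move=> q; rewrite /toggle; have := H1 q.
  by case: (u q == l) => //; case: eqP => [|_]; [lia|case: eqP => //; lia].
- by exists p; split=> //; rewrite H.
- by move=> q; rewrite H; apply: H3.
Qed.

Lemma refines_toggle x : togglable x -> refines u x -> refines u (toggle u e z l x).
Proof.
case=> H1 [p0 [up0 xp0]] H3 /refinesP H.
have xl p : u p = l -> x p = x p0.
  move=> up; apply/eqP; rewrite eqn_leq (proj1 (H p p0)) ?(proj1 (H p0 p)) //;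
  by rewrite up0 up.
pose c := if x p0 == e then z else e.
have tE p : toggle u e z l x p = if u p == l then c else x p.
  rewrite /toggle /c; case: eqP => // /xl ->; case: eqP => // xe.
  by move: xp0; rewrite (negbTE (introN eqP xe)) /= => ->.
(* Compares the moved block, now at the letter [c], with any other block: the parity of [e] tells on
   which side of [l] a block at [e] or [z] lies, and [H1] leaves no letter in between. *)
have low q : u q <> l -> [/\ (l <= u q)%N -> (c <= x q)%N,
    (u q <= l)%N -> (x q <= c)%N & c = x q -> odd c -> False].
  move=> uq; have := H1 q; have := H3 q; have [H5 H6] := H q p0.
  have [H7 H8] := H p0 q; rewrite -up0 in uq *; rewrite /c.
  move: xp0 oez H5 H6 H7 H8; clear -ez uq.
  by case: (boolP (odd e)) => oe; case: (boolP (odd z)) => oz //;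
    case: (eqVneq (x p0) e) => /= [->|xe] xz _ ; try (move/eqP: xz => ->);
    rewrite ?oe ?oz => H5 H6 H7 H8 H3 H1; split; rewrite ?(negbTE oe) ?(negbTE oz) //; lia.
apply/refinesP => p q; rewrite !tE.
case: (eqVneq (u p) l) => [up|/eqP up]; case: (eqVneq (u q) l) => [uq|/eqP uq].
- by rewrite up uq.
- by have [L1 L2 L3] := low q uq; rewrite up; split=> // cx oc; case: L3.
- have [L1 L2 L3] := low p up; rewrite uq; split=> // cx oc.
  by case: L3 => //; rewrite -cx.
- exact: H.
Qed.

Lemma refsign_toggle x : togglable x -> refines u x ->
  refsign u (toggle u e z l x) = - refsign u x.
Proof.
case=> H1 [p0 [up0 xp0]] H3 /refinesP H.
have ln : (l < n)%N by rewrite -up0.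
have xl p : u p = l -> x p = x p0.
  move=> up; apply/eqP; rewrite eqn_leq (proj1 (H p p0)) ?(proj1 (H p0 p)) //;
  by rewrite up0 up.
rewrite /refsign (bigD1 (Ordinal ln)) //= [in RHS](bigD1 (Ordinal ln)) //=.
rewrite -mulNr; congr (_ * _).
  have E (y : 'I_n -> nat) : (forall p, u p = l -> y p = y p0) ->
      [exists p, (u p == l) && ~~ odd (y p)] = ~~ odd (y p0).
    move=> Hy; apply/existsP/idP => [[p /andP[/eqP up]]|o]; first by rewrite Hy.
    by exists p0; rewrite up0 eqxx.
  rewrite !E //; last by move=> p up; rewrite /toggle up up0 eqxx xl.
  rewrite /toggle up0 eqxx.
  case/orP: xp0 => /eqP ->; rewrite eqxx.
    by move: oez; case: (odd e); case: (odd z); rewrite //= ?expr0 ?expr1 ?opprK.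
  have -> : (z == e) = false by apply/eqP => ze; move: ez; rewrite ze ltnn.
  by move: oez; case: (odd e); case: (odd z); rewrite //= ?expr0 ?expr1 ?opprK.
apply: eq_bigr => i il; congr (_ ^+ nat_of_bool _); apply: eq_existsb => p.
rewrite /toggle; case: (eqVneq (u p) l) => // upl.
suff -> : (u p == i) = false by [].
by apply: contraNF il => /eqP upi; apply/eqP/val_inj => /=; rewrite -upi.
Qed.

Lemma refcoef_toggle x : togglable x ->
  refcoef u (toggle u e z l x) = - refcoef u x.
Proof.
move=> tx; rewrite /refcoef; case: ifP => [ctx|/negbT nctx].
  rewrite -[x in refines _ x](_ : toggle u e z l (toggle u e z l x) = x); last first.
    by apply/boolp.funext/toggleK.
  have := refines_toggle (togglable_toggle tx) ctx => cx.
  by rewrite cx refsign_toggle // -[x in refines _ x](boolp.funext (toggleK u e z l x)).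
case: ifP => [cx|_]; last by rewrite oppr0.
by rewrite refines_toggle in nctx.
Qed.

End Toggle.

(** The block to toggle is chosen from the set [R] of positions alone, so the same block is chosen
    before and after toggling, which makes toggling an involution. *)
Lemma block_level (u : 'I_n -> nat) (b : bool) (R : {set 'I_n}) : R != set0 ->
  exists l, (exists p, u p = l /\ p \in R) /\
    forall p, p \in R -> if b then (l <= u p)%N else (u p <= l)%N.
Proof.
case/set0Pn => p0 p0R; case: b.
  case: (arg_minnP (P := fun p => p \in R) u p0R) => q qR H.
  by exists (u q); split=> //; exists q.
case: (arg_maxnP (P := fun p => p \in R) u p0R) => q qR H.
by exists (u q); split=> //; exists q.
Qed.

(** The sum equals its own opposite, hence vanishes in characteristic zero; at a fixed point of [h]
    the summand itself vanishes. *)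
Lemma sum_sign_involution (T : finType) (h : T -> T) (P : pred T) (F : T -> K) :
  (forall t, P t -> h (h t) = t) -> (forall t, P t -> P (h t)) ->
  (forall t, P t -> F (h t) = - F t) -> \sum_(t | P t) F t = 0.
Proof.
move=> hK hP hF.
have E : \sum_(t | P t) F t = - \sum_(t | P t) F t.
  rewrite [LHS](reindex_onto h h) // -sumrN.
  rewrite (eq_bigl P) => [|t].
    by apply: eq_bigr => t Pt; rewrite hF.
  apply/andP/idP => [[Pt /eqP e]|Pt]; last by rewrite hP // hK // eqxx.
  by have := hP _ Pt; rewrite e.
apply/eqP; rewrite -[_ == 0](mulrn_eq0 _ 2) mulr2n {1}E addNr eqxx //.
Qed.

End SignedRefinements.

(** * Packed words as maps *)

Section PackedMaps.
Variable n : nat.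
Implicit Types (f g : 'I_n -> nat).

Lemma same_order_lt f g : same_order f g ->
  forall p q, (f p < f q)%N = (g p < g q)%N.
Proof. by move=> H p q; rewrite !ltnNge H. Qed.

Lemma same_order_sym f g : same_order f g -> same_order g f.
Proof. by move=> H p q; rewrite H. Qed.

Lemma same_order_trans f g h : same_order f g -> same_order g h -> same_order f h.
Proof. by move=> H H' p q; rewrite H. Qed.

Definition gapless f := forall p j, (j < f p)%N -> exists q, f q = j.

(** All values below [f p] are taken, so [g] has to climb at least once for each of them. *)
Lemma gapless_le f g : gapless f -> same_order f g -> forall p, (f p <= g p)%N.
Proof.
move=> gf fg p; move: {2}(f p) (erefl (f p)) => k.
elim: k p => [|k IH] p fp; first by rewrite fp.
have [|q fq] := gf p k; first by rewrite fp.
by rewrite fp -fq (leq_ltn_trans (IH _ fq)) // -(same_order_lt fg) fq fp.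
Qed.

Lemma gapless_inj f g : gapless f -> gapless g -> same_order f g -> f =1 g.
Proof.
by move=> gf gg fg p; apply/eqP; rewrite eqn_leq !gapless_le.
Qed.

Definition is_gapless (u : {ffun 'I_n -> 'I_n}) :=
  [forall p, forall j : 'I_n, (j < u p)%N ==> [exists q, u q == j]].

(** Packed words of length [n] with letters counted from 0, as a finite type that can index sums and
    matrices. *)
Definition packing := {u : {ffun 'I_n -> 'I_n} | is_gapless u}.

Definition pfun (u : packing) : 'I_n -> nat := fun i => val u i.
Coercion pfun : packing >-> Funclass.

Lemma packing_gapless (u : packing) : gapless u.
Proof.
move=> p j jp; have jn : (j < n)%N := leq_trans jp (ltnW (ltn_ord (val u p))).
have := valP u; rewrite /is_gapless => /forallP/(_ p)/forallP/(_ (Ordinal jn)).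
by move/implyP/(_ jp)/existsP => [q /eqP uq]; exists q; rewrite /pfun uq.
Qed.

Lemma pfun_lt (u : packing) p : (u p < n)%N.
Proof. exact: ltn_ord. Qed.

Lemma packing_inj (u v : packing) : u =1 v -> u = v.
Proof. by move=> uv; apply/val_inj/ffunP => p; apply/val_inj/uv. Qed.

Definition word f : seq nat := [seq f i | i <- enum 'I_n].

Lemma size_word f : size (word f) = n.
Proof. by rewrite size_map size_enum_ord. Qed.

Definition rank f p := index (f p) (sort leq (undup (word f))).

Lemma rank_mem f p : f p \in sort leq (undup (word f)).
Proof. by rewrite mem_sort mem_undup map_f // mem_enum. Qed.

Lemma rank_lt f p : (rank f p < n)%N.
Proof.
apply: leq_trans (_ : size (sort leq (undup (word f))) <= _)%N.
  by rewrite index_mem rank_mem.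
by rewrite size_sort (leq_trans (size_undup _)) // size_word.
Qed.

Lemma same_order_rank f : same_order (rank f) f.
Proof.
have ss : sorted leq (sort leq (undup (word f))).
  by apply: sort_sorted; apply: leq_total.
move=> p q; apply/idP/idP.
  by apply: (sorted_leq_index leq_trans) => //; rewrite ?rank_mem.
rewrite leqNgt => H; rewrite leqNgt; apply: contraNN H => H.
rewrite ltn_neqAle; apply/andP; split.
  by apply: contraTneq H => e; rewrite /rank e ltnn.
by apply: (sorted_leq_index leq_trans leqnn ss); rewrite ?rank_mem // ltnW.
Qed.

Lemma gapless_rank f : gapless (rank f).
Proof.
move=> p j jp; set s := sort leq (undup (word f)).
have js : (j < size s)%N.
  by apply: ltn_trans jp _; rewrite /rank index_mem rank_mem.
have : nth 0%N s j \in s by rewrite mem_nth.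
rewrite mem_sort mem_undup => /mapP[q _ e]; exists q.
by rewrite /rank -e index_uniq // sort_uniq undup_uniq.
Qed.

Definition packff f : {ffun 'I_n -> 'I_n} := [ffun p => Ordinal (rank_lt f p)].

Lemma packff_subproof f : is_gapless (packff f).
Proof.
apply/forallP => p; apply/forallP => j; apply/implyP; rewrite ffunE /= => jp.
have [q fq] := gapless_rank jp; apply/existsP; exists q.
by rewrite ffunE; apply/eqP/val_inj.
Qed.

Definition packf f : packing :=
  exist (fun u => is_true (is_gapless u)) (packff f) (packff_subproof f).

Lemma packfE f : packf f =1 rank f.
Proof. by move=> p; rewrite /packf /pfun /= ffunE. Qed.

Lemma same_order_packf f : same_order (packf f) f.
Proof. by move=> p q; rewrite !packfE same_order_rank. Qed.

Lemma eq_packf f (u : packing) : same_order f u -> packf f = u.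
Proof.
move=> fu; apply/packing_inj/gapless_inj; try exact: packing_gapless.
exact: same_order_trans (same_order_packf f) fu.
Qed.

Lemma packf_same_order f g : same_order f g -> packf f = packf g.
Proof.
move=> fg; apply: eq_packf; apply: same_order_trans fg _.
exact/same_order_sym/same_order_packf.
Qed.

Lemma packfK (u : packing) : packf u = u.
Proof. exact: eq_packf. Qed.

Definition pword (u : packing) : seq nat := [seq (u i).+1 | i <- enum 'I_n].

Lemma pack_word f : pack (word f) = pword (packf f).
Proof.
by rewrite /pack /pword /word -map_comp; apply: eq_map => p /=; rewrite packfE.
Qed.

Lemma size_pword u : size (pword u) = n.
Proof. by rewrite size_map size_enum_ord. Qed.

Lemma pword_inj : injective pword.
Proof.
move=> u v /eq_in_map H; apply: packing_inj => p.
by have := H p; rewrite mem_enum => /(_ isT) [].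
Qed.

Lemma packed_pword u : packed (pword u).
Proof.
apply/andP; split; first by apply/negP => /mapP[].
apply/allP => _ /mapP[p _ ->]; apply/implyP => /= j0.
have [|q uq] := @packing_gapless u p (u p).-1; first by rewrite prednK.
by apply/mapP; exists q; rewrite ?mem_enum // uq prednK.
Qed.

End PackedMaps.

(** * The projector along K_n *)

Section Projector.
Variables (K : numFieldType) (n : nat).
Implicit Types (phi : packing n -> K) (w x : 'I_n -> nat) (R : {set 'I_n}).
Local Notation rcoef := (refcoef K).

(** The coefficient of the word [x] in [F(A)], where [phi u] is the coefficient of [P_u] in [F]; see
    [nccoef_evalA_of]. *)
Definition signed_eval phi x := \sum_(u : packing n) phi u * rcoef u x.

Lemma signed_eval_ext phi x y : same_order x y ->
  (forall p, odd (x p) = odd (y p)) -> signed_eval phi x = signed_eval phi y.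
Proof.
by move=> xy oxy; apply: eq_bigr => u _; rewrite (refcoef_ext _ _ xy oxy).
Qed.

(** On positive letters [g] is forced to be injective and no sign appears: there [F(A)] is [F]. *)
Lemma signed_eval_odd phi x : (forall p, odd (x p)) ->
  signed_eval phi x = phi (packf x).
Proof.
move=> ox; rewrite /signed_eval (bigD1 (packf x)) //= big1 ?addr0.
  rewrite /refcoef ifT; last first.
    apply/refinesP => p q; rewrite same_order_packf; split=> // xpq _.
    by apply/eqP; rewrite eqn_leq !same_order_packf xpq leqnn.
  rewrite /refsign big1 ?mulr1 // => l _.
  rewrite (_ : [exists _, _] = false) ?expr0 //.
  by apply/existsP => -[p]; rewrite ox andbF.
move=> u; apply: contraNeq; rewrite mulf_eq0 negb_or => /andP[_].
rewrite /refcoef; case: refinesP => [H|]; last by rewrite eqxx.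
move=> _; apply/eqP/esym/eq_packf => p q.
apply/idP/idP; last exact: (proj1 (H p q)).
move=> xpq; rewrite leqNgt; apply/negP => uqp.
have [H1 H2] := H q p.
have e : x q = x p by apply/eqP; rewrite eqn_leq xpq H1 // ltnW.
by have := H2 e (ox q) => e'; rewrite e' ltnn in uqp.
Qed.

(* The letters of w outside R become positive, and those in R become a single
   negative letter, placed after all others if z exceeds the letters of w. *)
Definition split_word w R z : 'I_n -> nat :=
  fun q => if q \in R then z.*2 else (w q).*2.+1.

Definition set_on w R e : 'I_n -> nat := fun q => if q \in R then e else w q.

Lemma set_on0 w e : set_on w set0 e = w.
Proof. by apply: boolp.funext => q; rewrite /set_on inE. Qed.

(** This is the coefficient, in [F(Y + y - y)], of a word with [y] exactly at the positions in [R].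
    The letters standing for y and -y are the two largest ones, so they cancel by toggling. *)
Lemma signed_eval_split_sum phi w R e z : R != set0 -> (e < z)%N ->
  (forall q, q \notin R -> (w q < e)%N) ->
  \sum_(S : {set 'I_n} | S \subset R)
     signed_eval phi (split_word (set_on w S e) (R :\: S) z) = 0.
Proof.
move=> R0 ez we.
pose X (S : {set 'I_n}) := split_word (set_on w S e) (R :\: S) z.
suff H (u : packing n) : \sum_(S : {set 'I_n} | S \subset R) rcoef u (X S) = 0.
  by rewrite exchange_big big1 // => u _; rewrite -mulr_sumr H mulr0.
have XE (S : {set 'I_n}) q : S \subset R -> X S q =
    if q \in R then (if q \in S then e.*2.+1 else z.*2) else (w q).*2.+1.
  move=> /subsetP SR; rewrite /X /split_word /set_on inE.
  case: (boolP (q \in S)) => [/SR -> //|qS] /=; by case: (q \in R).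
have XR (S : {set 'I_n}) q : S \subset R -> (X S q == e.*2.+1) || (X S q == z.*2) = (q \in R).
  move=> SR; rewrite XE //; case: ifP => qR; first by case: ifP; rewrite !eqxx ?orbT.
  by have := we q; rewrite qR => /(_ isT); lia.
(* Of the two letters the positive one, [e.*2.+1], comes first, so the least block meeting [R] is
   moved. On subsets of [R] the move is the symmetric difference with [B]. *)
have [l [[p [upl pR]] lR]] := block_level u true R0.
pose B := [set q in R | u q == l].
pose h (S : {set 'I_n}) := (S :\: B) :|: (B :\: S).
have BR : B \subset R by apply/subsetP => q; rewrite inE => /andP[].
have hR (S : {set 'I_n}) : S \subset R -> h S \subset R.
  move=> SR; rewrite subUset !(subset_trans (subsetDl _ _)) //.
apply: (sum_sign_involution (h := h)) => S SR.
- by apply/setP => q; rewrite !inE; case: (q \in S); case: (q \in R); case: (u q == l).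
- exact: hR.
have tS : togglable u e.*2.+1 z.*2 l (X S).
  split.
  - move=> q; rewrite XE //; case: ifP => qR; first by case: ifP => _; lia.
    by have := we q; rewrite qR => /(_ isT); lia.
  - by exists p; rewrite upl XR.
  - by move=> q; rewrite XR //= odd_double /=; apply: lR.
have ez2 : (e.*2.+1 < z.*2)%N by lia.
have oez : odd e.*2.+1 != odd z.*2 by rewrite /= !odd_double.
rewrite -[RHS](refcoef_toggle K (@pfun_lt _ u) ez2 oez tS).
congr (refcoef _ _); apply: boolp.funext => q.
rewrite -/(X _) -/(X _) XE ?hR // /toggle XE // !inE.
have ne : (z.*2 == e.*2.+1) = false by apply/eqP; lia.
case: (boolP (q \in R)) => qR; case: (eqVneq (u q) l) => //= _; rewrite ?andbT ?andbF ?orbF //.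
  by case: (q \in S); rewrite /= ?eqxx ?ne.
have := we q qR; case: eqP; first by lia.
by case: eqP => //; lia.
Qed.

(** These are the coordinates of the elements [(G * P_1) . s] in which the letter of [P_1] lands at
    position [p]; see [indep_Kcal_deg]. All words are quantified over, since changing one letter of
    a packed word may leave it unpacked. *)
Definition indep p phi :=
  forall f g : 'I_n -> nat, (forall q, q != p -> f q = g q) ->
    phi (packf f) = phi (packf g).

(** Strong induction on [#|R|]: [signed_eval_split_sum] expresses the term in which all of [R] is
    negative by terms with fewer negative positions, down to none, where the evaluation is [phi].
    Each round spends a fresh positive letter [b] below the negative one, whence [b + k <= z]. *)
Lemma signed_eval_split_indep phi p : indep p phi -> forall k R w w' b z,
  #|R| = k -> p \notin R -> (forall q, q \notin R -> w q < b /\ w' q < b)%N ->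
  (forall q, q != p -> w q = w' q) -> (b + k <= z)%N ->
  signed_eval phi (split_word w R z) = signed_eval phi (split_word w' R z).
Proof.
move=> ip; elim/ltn_ind => k IH R w w' b z Rk pR wb ww' bz.
have [R0|R0] := eqVneq R set0.
  rewrite !signed_eval_odd; try by move=> q; rewrite R0 /split_word inE /= odd_double.
  by apply: ip => q /ww' e; rewrite R0 /split_word inE e.
have k0 : (0 < k)%N by rewrite -Rk card_gt0.
have E w1 : (forall q, q \notin R -> w1 q < b)%N ->
   signed_eval phi (split_word w1 R z) =
   - \sum_(S : {set 'I_n} | (S \subset R) && (S != set0))
     signed_eval phi (split_word (set_on w1 S b) (R :\: S) z).
  move=> w1b; have bz' : (b < z)%N by lia.
  have /eqP := signed_eval_split_sum phi R0 bz' w1b.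
  by rewrite (bigD1 set0) ?sub0set //= addr_eq0 setD0 set_on0 => /eqP ->.
rewrite !E; try by move=> q /wb[].
congr (- _); apply: eq_bigr => S /andP[SR S0].
have SRk : #|R :\: S| = (k - #|S|)%N by rewrite cardsDS // Rk.
have Sk : (#|S| <= k)%N by rewrite -Rk subset_leq_card.
have S1 : (0 < #|S|)%N by rewrite card_gt0.
apply: (IH (k - #|S|)%N _ _ _ _ b.+1) => //.
- by lia.
- by rewrite inE negb_and pR orbT.
- move=> q; rewrite inE /set_on; case: ifP => //= _ /wb; lia.
- by move=> q qp; rewrite /set_on ww'.
- by lia.
Qed.

(* Moving the letter at p from the block R of virtual letters to an arbitrary
   real letter changes the sign: this is P_1 = 0 on the virtual alphabet. *)
Lemma signed_eval_split_virtual phi p : indep p phi -> forall k R w b z,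
  #|R| = k -> p \in R -> (forall q, q \notin R -> w q < b)%N -> (w p < b)%N ->
  (b + k <= z)%N ->
  signed_eval phi (split_word w R z) = - signed_eval phi (split_word w (R :\ p) z).
Proof.
move=> ip; elim/ltn_ind => k IH R w b z Rk pR wb wpb bz.
have R0 : R != set0 by apply/set0Pn; exists p.
have k0 : (0 < k)%N by rewrite -Rk card_gt0.
have bz' : (b < z)%N by lia.
have /eqP := signed_eval_split_sum phi R0 bz' wb.
have cQ : #|R :\ p| = k.-1 by rewrite -Rk (cardsD1 p R) pR.
rewrite (bigID (fun S : {set 'I_n} => p \in S)) /=.
(* Each [S] without [p] is paired with [p |: S]. By induction the two terms cancel unless [S] is
   empty, and that last pair is the claim. *)
rewrite (reindex_onto (fun S => p |: S) (fun S => S :\ p)); last first.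
  by move=> S /andP[_ pS]; rewrite setD1K.
rewrite [X in X + _](eq_bigl (fun S : {set 'I_n} => S \subset R :\ p)); last first.
  move=> S /=; rewrite subUset sub1set pR setU11 /= andbT subsetD1; congr (_ && _).
  apply/eqP/idP => [<-|pS]; first by rewrite !inE eqxx.
  by rewrite setU1K.
rewrite [X in _ + X](eq_bigl (fun S : {set 'I_n} => S \subset R :\ p)); last first.
  by move=> S; rewrite subsetD1.
rewrite -big_split /= (bigD1 set0) ?sub0set //= [X in _ + X]big1.
  rewrite addr0 setU0 setD0 set_on0 addrC addr_eq0 => /eqP ->; congr (- _).
  apply: (signed_eval_split_indep ip (k := k.-1) (b := b.+1)) => //.
  - by rewrite !inE eqxx.
  - move=> q; rewrite !inE negb_and negbK /set_on inE => /orP[/eqP ->|/wb].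
      by rewrite eqxx; lia.
    by case: eqP; lia.
  - by move=> q qp; rewrite /set_on inE (negbTE qp).
  - by lia.
move=> S /andP[SQ S0].
have pS : p \notin S by apply: contraTN SQ => pS; apply/subsetPn; exists p; rewrite // !inE eqxx.
have S1 : (0 < #|S|)%N by rewrite card_gt0.
have SR : S \subset R by apply: subset_trans SQ (subsetDl _ _).
have SRk : #|R :\: S| = (k - #|S|)%N by rewrite cardsDS // Rk.
have Sk : (#|S| <= k)%N by rewrite -Rk subset_leq_card.
rewrite (IH (k - #|S|)%N _ (R :\: S) _ b.+1) //; last 5 first.
- by lia.
- by rewrite inE pS.
- by move=> q; rewrite inE /set_on; case: ifP => //= _ /wb; lia.
- by rewrite /set_on (negbTE pS) ltnW // ltnS.
- by lia.
apply/eqP; rewrite subr_eq0; apply/eqP.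
rewrite (_ : R :\: (p |: S) = (R :\: S) :\ p); last first.
  by apply/setP => q; rewrite !inE negb_or; case: (q == p); rewrite /= ?andbF.
apply: (signed_eval_split_indep ip (k := (k - #|S|).-1) (b := b.+1)) => //.
- by rewrite -SRk (cardsD1 p (R :\: S)) !inE pS pR.
- by rewrite !inE eqxx.
- move=> q; rewrite !inE negb_and negbK /set_on !inE.
  case: (eqVneq q p) => [->|qp] /=; first by rewrite (negbTE pS); lia.
  by case: (q \in S) => //= /wb; lia.
- by move=> q qp; rewrite /set_on !inE (negbTE qp).
- by lia.
Qed.

(* The coefficient of P_v in F(Y - P_1(Y)) for F = P_u: R is the set of the
   positions whose letter is taken from the subtracted P_1(Y). *)
Definition virtual_coef (u v : packing n) : K :=
  \sum_(R : {set 'I_n}) rcoef u (split_word v R n).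

Lemma sum_virtual_coef phi v : \sum_u phi u * virtual_coef u v =
  \sum_(R : {set 'I_n}) signed_eval phi (split_word v R n).
Proof.
rewrite exchange_big /=; apply: eq_bigr => u _; exact: mulr_sumr.
Qed.

Lemma virtual_indep phi p v : indep p phi -> \sum_u phi u * virtual_coef u v = 0.
Proof.
move=> ip; rewrite sum_virtual_coef.
(* Only order and parity matter, so the negative letter may be moved up; [n.*2] leaves room for the
   at most [n] fresh letters that [signed_eval_split_virtual] spends above the letters of [v]. *)
have E R : signed_eval phi (split_word v R n) =
           signed_eval phi (split_word v R n.*2).
  apply: signed_eval_ext => [q r|q]; rewrite /split_word; last first.
    by case: ifP => _; rewrite /= !odd_double.
  have := pfun_lt v q; have := pfun_lt v r.
  by case: ifP => _; case: ifP => _; lia.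
under eq_bigr => R _ do rewrite E.
pose h R := if p \in R then R :\ p else p |: R.
apply: (sum_sign_involution (h := h) (P := xpredT)) => // R _.
  rewrite /h; case: (boolP (p \in R)) => pR; first by rewrite !inE eqxx setD1K.
  by rewrite setU11 setU1K.
have V (S : {set 'I_n}) : p \in S -> signed_eval phi (split_word v S n.*2) =
                 - signed_eval phi (split_word v (S :\ p) n.*2).
  move=> pS; apply: (signed_eval_split_virtual ip (b := n) (erefl _)) => //.
  - by move=> q _; apply: pfun_lt.
  - exact: pfun_lt.
  - by have := max_card S; rewrite card_ord; lia.
rewrite /h; case: (boolP (p \in R)) => pR; first by rewrite [in RHS]V // opprK.
by rewrite V ?setU11 // setU1K.
Qed.

Lemma indep_split phi R p : p \in R ->
  indep p (fun v => signed_eval phi (split_word v R n)).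
Proof.
move=> pR f g fg; apply: signed_eval_ext => [q r|q]; rewrite /split_word; last first.
  by case: ifP => _; rewrite /= !odd_double.
have := pfun_lt (packf f) q; have := pfun_lt (packf f) r.
have := pfun_lt (packf g) q; have := pfun_lt (packf g) r.
case: (boolP (q \in R)) => qR; case: (boolP (r \in R)) => rR; try lia.
move=> _ _ _ _; rewrite !ltnS !leq_double !same_order_packf !fg //.
- by apply: contraNneq rR => ->.
- by apply: contraNneq qR => ->.
Qed.

(** The term of the empty [R] gives back [phi v]. By [indep_split] each remaining term ignores a
    position, so rho is the identity modulo [K_n]. *)
Lemma virtual_coef_decomp phi v : phi v - \sum_u phi u * virtual_coef u v =
  - \sum_(R : {set 'I_n} | R != set0) signed_eval phi (split_word v R n).
Proof.
rewrite sum_virtual_coef (bigD1 set0) //= opprD addrA.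
rewrite signed_eval_odd => [|q]; last by rewrite /split_word inE /= odd_double.
rewrite (_ : packf _ = v) ?subrr ?add0r //; apply: eq_packf => q r.
by rewrite /split_word !inE ltnS leq_double.
Qed.

Definition nletters (u : packing n) : nat := \max_p (u p).+1.

Lemma ltn_nletters (u : packing n) p : (u p < nletters u)%N.
Proof. exact: (leq_bigmax p). Qed.

Lemma nlettersP (u : packing n) j : (j < nletters u)%N -> exists p, u p = j.
Proof.
move=> jr; have [p] : exists p, (j < (u p).+1)%N.
  apply/existsP; apply: contraLR jr; rewrite negb_exists -leqNgt => /forallP H.
  by apply/bigmax_leqP => p _; rewrite leqNgt.
rewrite ltnS leq_eqVlt => /orP[/eqP ->|]; first by exists p.
exact: packing_gapless.
Qed.

Lemma nletters_le (u : packing n) : (nletters u <= n)%N.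
Proof. by apply/bigmax_leqP => p _; apply: (pfun_lt u p). Qed.

Lemma alternating_sum r : \sum_(i < r.+1) (-1) ^+ (r - i) = (~~ odd r)%:R :> K.
Proof.
rewrite (reindex_inj rev_ord_inj) /=.
rewrite (eq_bigr (fun i : 'I_r.+1 => (-1) ^+ i)); last first.
  by move=> i _; rewrite subSS subKn // -ltnS.
elim: r => [|r IH]; first by rewrite big_ord1.
rewrite big_ord_recr /= IH -signr_odd /=.
by case: (odd r); rewrite /= ?expr0 ?expr1 ?add0r ?subrr.
Qed.

(** The letter given to [R] exceeds all others, so [u] refines to [split_word u R n] only if [R] is
    the union of the last blocks of [u]. Cutting before block [i] makes [r - i] blocks negative. *)
Lemma virtual_coef_diag (u : packing n) : virtual_coef u u = (~~ odd (nletters u))%:R.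
Proof.
set r := nletters u; pose h (i : 'I_r.+1) := [set p | (i <= u p)%N].
have hinj : injective h.
  move=> i j /setP H; apply/val_inj/eqP => /=; rewrite eqn_leq.
  have le (a b : 'I_r.+1) : (forall p, (p \in h a) = (p \in h b)) -> (a <= b)%N.
    move=> {}H; rewrite leqNgt; apply/negP => ba.
    have [p up] : exists p, u p = b by apply: nlettersP; have := ltn_ord a; lia.
    by have := H p; rewrite !inE up leqnn leqNgt ba.
  by rewrite !le.
have F (R : {set 'I_n}) : R \notin [set h i | i : 'I_r.+1] -> rcoef u (split_word u R n) = 0.
  rewrite /refcoef; case: refinesP => // H /negP[].
  have up p q : p \in R -> (u p <= u q)%N -> q \in R.
    move=> pR pq; have [/(_ pq) + _] := H p q; rewrite /split_word pR.
    by case: ifP => // _; have := pfun_lt u q; lia.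
  (* The empty [R] is the cut after the last block, so there are [r.+1] cuts in all. *)
  have [R0|/set0Pn[p0 p0R]] := eqVneq R set0.
    apply/imsetP; exists ord_max => //; apply/setP => q; rewrite R0 !inE /=.
    by have := ltn_nletters u q; rewrite -/r; lia.
  case: (arg_minnP (P := fun p => p \in R) u p0R) => p pR Hp.
  have ip : (u p < r.+1)%N by rewrite ltnS ltnW // ltn_nletters.
  apply/imsetP; exists (Ordinal ip) => //; apply/setP => q; rewrite !inE /=.
  by apply/idP/idP; [apply: Hp|apply: up].
rewrite /virtual_coef (bigID (fun R => R \in [set h i | i : 'I_r.+1])) /=.
rewrite [X in _ + X]big1 ?addr0 => [|R /F //].
rewrite big_imset /=; last by move=> i j _ _; apply: hinj.
rewrite -alternating_sum; apply: eq_bigr => i _.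
have E q : (q \in h i) = (i <= u q)%N by rewrite inE.
rewrite /refcoef ifT; last first.
  apply/refinesP => p q; rewrite /split_word !E.
  have := pfun_lt u p; have := pfun_lt u q; case: ifP => Hp; case: ifP => Hq; lia.
rewrite /refsign.
have -> : \prod_(l < n) (-1) ^+ [exists p, (u p == l) && ~~ odd (split_word u (h i) n p)]
   = \prod_(l < n) (-1 : K) ^+ (i <= l < r)%N.
  apply: eq_bigr => l _; congr (_ ^+ nat_of_bool _).
  apply/existsP/idP => [[p /andP[/eqP <-]]|/andP[il lr]].
    rewrite ltn_nletters andbT /split_word E; case: ifP => //=.
    by rewrite odd_double.
  have [p up] := nlettersP lr; exists p; rewrite up eqxx /split_word E up il /=.
  by rewrite odd_double.
rewrite -(big_mkord xpredT (fun l => (-1 : K) ^+ (i <= l < r)%N)).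
have rn := nletters_le u; have ir : (i <= r)%N by rewrite -ltnS.
rewrite (@big_cat_nat _ _ _ i) //=; last exact: leq_trans ir rn.
rewrite (@big_cat_nat _ _ _ r i n) //= big_nat big1 ?mul1r => [|l /andP[_ li]]; last first.
  by rewrite leqNgt li expr0.
rewrite [X in _ * X]big_nat [X in _ * X]big1 ?mulr1 => [|l /andP[rl _]]; last first.
  by rewrite [(l < r)%N]ltnNge rl andbF expr0.
rewrite big_nat (eq_bigr (fun=> -1)) => [|l /andP[il lr]]; last by rewrite il lr expr1.
by rewrite -big_nat prodr_const_nat.
Qed.

End Projector.

(** * Coefficients of noncommutative polynomials *)

Section NcCoefficients.
Variables (K : fieldType) (I : choiceType).
Implicit Types (p q : ncpoly K I) (w : seq I).

Lemma nccoefP p q : (forall w, nccoef p w = nccoef q w) -> p = q.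
Proof. by move=> H; apply/malgP => k; have := H k; rewrite /nccoef fmK. Qed.

Lemma nccoefD p q w : nccoef (p + q) w = nccoef p w + nccoef q w.
Proof. exact: mcoeffD. Qed.

Lemma nccoef0 w : nccoef (0 : ncpoly K I) w = 0.
Proof. exact: mcoeff0. Qed.

Lemma nccoefN p w : nccoef (- p) w = - nccoef p w.
Proof. exact: mcoeffN. Qed.

Lemma nccoefZ c p w : nccoef (c *: p) w = c * nccoef p w.
Proof. exact: mcoeffZ. Qed.

Lemma nccoef_sum (T : Type) (r : seq T) (P : pred T) (F : T -> ncpoly K I) w :
  nccoef (\sum_(i <- r | P i) F i) w = \sum_(i <- r | P i) nccoef (F i) w.
Proof. exact: raddf_sum. Qed.

Lemma nccoef_word v w : nccoef (ncword K v) w = (v == w)%:R.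
Proof. by rewrite /nccoef mcoeffU1. Qed.

Lemma nccoef_var i w : nccoef (ncvar K i) w = (w == [:: i])%:R.
Proof. by rewrite nccoef_word eq_sym. Qed.

Lemma nccoef1 w : nccoef (1 : ncpoly K I) w = (w == [::])%:R.
Proof. by rewrite /nccoef mcoeff1 fmP fm1. Qed.

Lemma nccoef_supp p w :
  nccoef p w = \sum_(k <- msupp p) p@_k * ((k : seq I) == w)%:R.
Proof.
rewrite {1}/nccoef {1}[p]monalgE raddf_sum /=; apply: eq_bigr => k _.
by rewrite mcoeffU mulr_natr fmP.
Qed.

Lemma msupp_nccoef p w : nccoef p w != 0 -> FMonom w \in msupp p.
Proof. by rewrite mcoeff_neq0. Qed.

Lemma nccoefM p q w : nccoef (p * q) w =
  \sum_(i < (size w).+1) nccoef p (take i w) * nccoef q (drop i w).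
Proof.
rewrite /nccoef mcoeffMl -/(nccoef _ _).
transitivity (\sum_(k1 <- msupp p) \sum_(k2 <- msupp q) \sum_(i < (size w).+1)
   p@_k1 * ((k1 : seq I) == take i w)%:R * (q@_k2 * ((k2 : seq I) == drop i w)%:R)).
  apply: eq_bigr => k1 _; apply: eq_bigr => k2 _; rewrite fmP fmM /=.
  case: eqP => [<-|ne].
    have lt : (size k1 < (size (k1 ++ k2)).+1)%N by rewrite ltnS size_cat leq_addr.
    rewrite (bigD1 (Ordinal lt)) //= take_size_cat // drop_size_cat // !eqxx !mulr1.
    rewrite big1 ?addr0 // => i ik; case: eqP => [e|]; last by rewrite mulr0 mul0r.
    case/eqP: ik; apply/val_inj => /=; have := congr1 size e.
    by rewrite size_takel => [/esym //|]; rewrite -ltnS; apply: ltn_ord.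
  rewrite big1 // => i _; case: eqP => [e1|_]; last by rewrite mulr0 mul0r.
  case: eqP => [e2|_]; last by rewrite !mulr0.
  by case: ne; rewrite e1 e2 cat_take_drop.
under eq_bigr do rewrite exchange_big.
rewrite exchange_big; apply: eq_bigr => i _ /=.
rewrite -!/(nccoef _ _) (nccoef_supp p) (nccoef_supp q) mulr_suml.
by apply: eq_bigr => k1 _; rewrite mulr_sumr.
Qed.

End NcCoefficients.

(** * Substitution of linear forms *)

Section LinearSubstitution.
Variables (K : fieldType) (I J : choiceType).

(** Every substitution in use sends letters to linear forms, so it preserves the degree and can be
    studied on words of one fixed length. *)
Definition linear_subst (L : I -> ncpoly K J) :=
  forall i s, size s != 1%N -> nccoef (L i) s = 0.

Lemma nccoef_prod_linear L : linear_subst L -> forall (v : seq I) (w : seq J),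
  nccoef (\prod_(x <- v) L x) w =
  if size v == size w
  then \prod_(xy <- zip v w) nccoef (L xy.1) [:: xy.2] else 0.
Proof.
move=> linL; elim=> [|x v IH] w.
  by rewrite big_nil nccoef1; case: w => //=; rewrite big_nil.
rewrite big_cons nccoefM; case: w => [|y w] /=.
  by rewrite big_ord1 linL ?mul0r.
rewrite (bigD1 (@Ordinal (size w).+2 1 isT)) //= take0 drop0 [X in _ + X]big1 ?addr0.
  by rewrite IH eqSS; case: eqP; rewrite ?big_cons ?mulr0.
move=> i i1; rewrite linL ?mul0r //.
rewrite size_takel; last by rewrite -ltnS (ltn_ord i).
by apply: contraNneq i1 => e; apply/eqP/val_inj.
Qed.

End LinearSubstitution.

(** On words of length [n] a linear substitution acts by the [n]-th tensor power of its matrix. *)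
Lemma nccoef_subst_linear (K : fieldType) (I : finType) (J : choiceType) (L : I -> ncpoly K J) p
    n (w : n.-tuple J) : linear_subst L ->
  nccoef (ncsubst L p) w =
  \sum_(v : n.-tuple I) nccoef p v *
     \prod_(q < n) nccoef (L (tnth v q)) [:: tnth w q].
Proof.
move=> linL; rewrite /ncsubst nccoef_sum.
transitivity (\sum_(k <- msupp p) \sum_(v : n.-tuple I)
   p@_k * ((k : seq I) == v)%:R * \prod_(q < n) nccoef (L (tnth v q)) [:: tnth w q]).
  apply: eq_bigr => k _; rewrite nccoefZ nccoef_prod_linear // size_tuple.
  case: eqP => [sk|ne].
    rewrite (bigD1 (tcast sk (in_tuple k))) //= val_tcast /= eqxx mulr1 [X in _ + X]big1 ?addr0; last first.
      move=> v /negP vk; case: eqP => [e|]; last by rewrite mulr0 mul0r.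
      by case: vk; apply/eqP/val_inj; rewrite /= val_tcast /= e.
    congr (_ * _); set t := tcast _ _; have -> : (k : seq I) = t by rewrite val_tcast.
    transitivity (\prod_(xy <- zip_tuple t w) nccoef (L xy.1) [:: xy.2]) => //.
    rewrite big_tuple; apply: eq_bigr => q _.
    by rewrite (tnth_nth (tnth t q, tnth w q)) /= nth_zip ?size_tuple //= -!tnth_nth.
  rewrite mulr0 big1 // => v _; case: eqP => [e|]; last by rewrite mulr0 mul0r.
  by case: ne; rewrite e size_tuple.
rewrite exchange_big; apply: eq_bigr => v _ /=.
by rewrite nccoef_supp mulr_suml.
Qed.

Section NcSeq.
Variables (K : fieldType) (I : nat -> choiceType).
Implicit Types (F G : ncseq K I).

Lemma ncseqP F G : (forall N w, nccoef (F N) w = nccoef (G N) w) -> F = G.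
Proof.
by move=> H; apply: boolp.functional_extensionality_dep => N; apply: nccoefP.
Qed.

Lemma nccoef_seqD F G N w : nccoef ((F + G) N) w = nccoef (F N) w + nccoef (G N) w.
Proof. exact: nccoefD. Qed.

Lemma nccoef_seq0 N w : nccoef ((0 : ncseq K I) N) w = 0.
Proof. exact: nccoef0. Qed.

Lemma nccoef_seqZ c F N w : nccoef ((c *: F) N) w = c * nccoef (F N) w.
Proof. exact: nccoefZ. Qed.

Lemma nccoef_seqM F G N w : nccoef ((F * G) N) w =
  \sum_(i < (size w).+1) nccoef (F N) (take i w) * nccoef (G N) (drop i w).
Proof. exact: nccoefM. Qed.

Lemma nccoef_seq_sum (T : Type) (r : seq T) (P : pred T) (F : T -> ncseq K I) N w :
  nccoef ((\sum_(i <- r | P i) F i) N) w = \sum_(i <- r | P i) nccoef (F i N) w.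
Proof.
elim: r => [|t r IH]; first by rewrite 2!big_nil nccoef_seq0.
by rewrite 2!big_cons; case: (P t) => //; rewrite nccoef_seqD IH.
Qed.

Lemma homogP d F : homog d F <-> forall N w, size w != d -> nccoef (F N) w = 0.
Proof.
split=> [H N w|H N w]; first by apply: contraNeq => /msupp_nccoef/H ->.
rewrite -mcoeff_neq0; apply: contraNeq => sw.
by have := H N w sw; rewrite /nccoef fmK => ->.
Qed.

End NcSeq.

(** * Coordinates of WQSym and coefficients of F(A) *)

Section Coefficients.
Variable K : numFieldType.

Definition tfun n N (w : n.-tuple 'I_N) : 'I_n -> nat := fun q => val (tnth w q).

Lemma word_tfun n N (w : n.-tuple 'I_N) : word (tfun w) = map val w.
Proof.
by rewrite /word /tfun (map_comp val (tnth w)) map_tnth_enum.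
Qed.

Lemma nccoef_WQ_P s N (w : seq 'I_N) :
  nccoef (WQ_P K s N) w = (pack (map val w) == s)%:R.
Proof.
rewrite /WQ_P nccoef_sum; have [ws|ws] := eqVneq (size w) (size s); last first.
  have -> : (pack (map val w) == s) = false.
    by apply: contraNF ws => /eqP <-; rewrite !size_map.
  rewrite big1 // => v _; rewrite nccoef_word; case: eqP => // e.
  by rewrite -e size_tuple eqxx in ws.
set t := tcast ws (in_tuple w); have tE : tval t = w by rewrite val_tcast.
rewrite -tE big_mkcond (bigD1 t) //= nccoef_word eqxx big1 ?addr0.
  by case: eqP.
move=> v vt; case: ifP => // _; rewrite nccoef_word.
by case: eqP => // e; case/eqP: vt; apply: val_inj.
Qed.

(** By [WQSym_homog], every element of WQSym of degree [n] has this form. *)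
Definition WQ_of n (phi : packing n -> K) : ncseq K a_alph :=
  \sum_u phi u *: WQ_P K (pword u).

Lemma nccoef_WQ_of n (phi : packing n -> K) N (w : n.-tuple 'I_N) :
  nccoef (WQ_of phi N) w = phi (packf (tfun w)).
Proof.
rewrite /WQ_of nccoef_seq_sum.
under eq_bigr => u _ do rewrite nccoef_seqZ nccoef_WQ_P -word_tfun pack_word.
rewrite (bigD1 (packf (tfun w))) //= eqxx mulr1 [X in _ + X]big1 ?addr0 // => u une.
case: eqP => [e|]; last by rewrite mulr0.
by rewrite (pword_inj e) eqxx in une.
Qed.

Lemma homog_WQ_of n (phi : packing n -> K) : homog n (WQ_of phi).
Proof.
apply/homogP => N w sw; rewrite /WQ_of nccoef_seq_sum big1 // => u _.
rewrite nccoef_seqZ nccoef_WQ_P; case: eqP; rewrite ?mulr0 // => e.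
by move: (congr1 size e) sw; rewrite size_pword !size_map => ->; rewrite eqxx.
Qed.

Lemma maxletter_pword n (u : packing n) : maxletter (pword u) = nletters u.
Proof. by rewrite /maxletter /pword big_map big_enum. Qed.

(** At most one map [g] contributes to the word [w]: the map [g0] below, which reads the letter of
    each block off a representative position. Its sign, a product over negative letters, is
    regrouped as a product over blocks. *)
Lemma nccoef_WQ_PA n (u : packing n) N (w : n.-tuple 'I_N) :
  nccoef (WQ_PA K (pword u) N) w = refcoef K u (tfun w).
Proof.
rewrite /WQ_PA; set r := maxletter _.
have rE : r = nletters u by rewrite /r maxletter_pword.
have ur p : (u p < r)%N by rewrite rE ltn_nletters.
pose o p := Ordinal (ur p).
have oE : ord_word r (pword u) = [seq o p | p <- enum 'I_n].
  apply: (inj_map val_inj); rewrite val_ord_word ?packed_pword //.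
  by rewrite /pword -!map_comp.
rewrite oE nccoef_sum.
have wE (g : {ffun 'I_r -> 'I_N}) :
    reflect (forall p, g (o p) = tnth w p)
            (map g [seq o p | p <- enum 'I_n] == w).
  rewrite -map_comp -[X in _ == X]map_tnth_enum; apply: (iffP eqP) => [/eq_in_map H p|H].
    by apply: H; rewrite mem_enum.
  by apply: eq_map => p /=.
under eq_bigr => g _ do rewrite nccoefZ nccoef_word.
have [p_ p_E] := fin_all_exists (fun i : 'I_r => nlettersP (leq_trans (ltn_ord i) (eq_leq rE))).
rewrite /refcoef; case: refinesP => [H|H]; last first.
  rewrite big1 // => g /andP[/forallP g1 /forallP g2]; case: wE => [gw|]; last by rewrite mulr0.
  case: H => p q; split=> [pq|].
    by rewrite /tfun -!gw; have /forallP/(_ (o q))/implyP := g1 (o p); apply.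
  rewrite /tfun -!gw => e od; have /implyP := g2 (g (o p)).
  rewrite /= negbK => /(_ od)/card_le1_eqP H.
  have /(congr1 val) : o p = o q; last by [].
  by apply: H; rewrite inE //; apply/eqP/esym/val_inj.
pose g0 : {ffun 'I_r -> 'I_N} := [ffun i => tnth w (p_ i)].
have g0w p : g0 (o p) = tnth w p.
  rewrite ffunE; apply/val_inj/eqP => /=; rewrite eqn_leq.
  have [H1 _] := H (p_ (o p)) p; have [H2 _] := H p (p_ (o p)).
  by rewrite /tfun p_E /= leqnn in H1 H2; rewrite H1 ?H2.
rewrite (bigD1 g0) /=; last first.
  apply/andP; split.
    apply/forallP => i; apply/forallP => k; apply/implyP => ik; rewrite !ffunE.
    by have [H1 _] := H (p_ i) (p_ k); apply: H1; rewrite !p_E.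
  apply/forallP => j; apply/implyP; rewrite negbK => oj.
  apply/card_le1_eqP => i k; rewrite !inE !ffunE => /eqP ei /eqP ek.
  have [_ H2] := H (p_ i) (p_ k); apply/val_inj => /=; rewrite -(p_E i) -(p_E k).
  by symmetry; apply: H2; rewrite /tfun ei ?ek.
rewrite (introT (wE g0) g0w) mulr1 [X in _ + X]big1 ?addr0; last first.
  move=> g /andP[_ gg0]; case: wE => [gw|]; last by rewrite mulr0.
  case/eqP: gg0; apply/ffunP => i; have -> : i = o (p_ i) by apply/val_inj; rewrite /= p_E.
  by rewrite gw g0w.
transitivity (\prod_(i : 'I_r) (-1 : K) ^+ ~~ odd (g0 i)).
  transitivity (\prod_(i : 'I_r | odd (g0 i).+1) (-1 : K)).
    rewrite (partition_big g0 (fun j : 'I_N => odd j.+1)) //=.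
    apply: eq_bigr => j oj; rewrite -prodr_const; apply: eq_bigl => i.
    by rewrite inE; case: eqP => [->|]; rewrite ?andbF ?andbT.
  by rewrite big_mkcond /=; apply: eq_bigr => i _; case: (odd _); rewrite /= ?expr0 ?expr1.
pose F l : K := (-1) ^+ [exists p, (u p == l) && ~~ odd (tfun w p)].
have rn : (r <= n)%N by rewrite rE nletters_le.
transitivity (\prod_(i < r) F i).
  apply: eq_bigr => i _; rewrite /F; congr (_ ^+ nat_of_bool _).
  apply/idP/existsP => [og|[p /andP[/eqP up op]]].
    by exists (p_ i); rewrite p_E eqxx /tfun; rewrite ffunE in og.
  suff -> : i = o p by rewrite g0w.
  by apply/val_inj; rewrite /= up.
(* The levels from [r] up to [n] carry no block and contribute 1; thanks to them the range of the
   product in [refsign] is the same for all [u]. *)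
rewrite (big_ord_widen _ _ rn) big_mkcond /=; apply: eq_bigr => l _.
case: ifP => // /negbT; rewrite -leqNgt => rl; rewrite /F.
rewrite (_ : [exists _, _] = false) ?expr0 //; apply/existsP => -[p].
by case/andP => /eqP up; have := ur p; rewrite up ltnNge rl.
Qed.

Lemma homog_WQ_PA n (u : packing n) : homog n (WQ_PA K (pword u)).
Proof.
apply/homogP => N w sw; rewrite /WQ_PA nccoef_sum big1 // => g _.
rewrite nccoefZ nccoef_word; case: eqP; rewrite ?mulr0 // => e; case/eqP: sw.
rewrite -e size_map -(size_map val) val_ord_word ?packed_pword //.
by rewrite size_map size_pword.
Qed.

Lemma WQSym_P n (u : packing n) : WQSym K (WQ_P K (pword u)).
Proof.
exists 1%N, (fun=> 1), (fun=> WQ_P K (pword u)); split.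
  by move=> _; exists (pword u); rewrite //= packed_pword.
by rewrite big_ord1 scale1r.
Qed.

Section Span.
Variable V : lmodType K.

Lemma lin_span_mem (S : classical_sets.set V) x : S x -> lin_span S x.
Proof.
move=> Sx; exists 1%N, (fun=> 1), (fun=> x); split=> //.
by rewrite big_ord1 scale1r.
Qed.

Lemma lin_span0 (S : classical_sets.set V) : lin_span S 0.
Proof.
by exists 0%N, (fun=> 0), (fun=> 0); split=> [[]|] //; rewrite big_ord0.
Qed.

Lemma lin_spanP (S : classical_sets.set V) c x y :
  lin_span S x -> lin_span S y -> lin_span S (c *: x + y).
Proof.
case=> n [a [f [Sf ->]]] [m [b [g [Sg ->]]]].
exists (n + m)%N, (fun i => match split i with inl j => c * a j | inr j => b j end),
  (fun i => match split i with inl j => f j | inr j => g j end); split.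
  by move=> i; case: (split i).
rewrite big_split_ord scaler_sumr; congr (_ + _); apply: eq_bigr => i _.
  by rewrite (unsplitK (inl i)) scalerA.
by rewrite (unsplitK (inr i)).
Qed.

Lemma lin_span_sum (S : classical_sets.set V) (T : Type) (r : seq T) (P : pred T) (c : T -> K) (F : T -> V) :
  (forall t, P t -> lin_span S (F t)) -> lin_span S (\sum_(t <- r | P t) c t *: F t).
Proof.
move=> H; elim/big_rec: _ => [|t x Pt Hx]; first exact: lin_span0.
by apply: lin_spanP => //; apply: H.
Qed.

(** Linearity is asked on a subspace [S] because the sum defining [evalA] is known to be finite, and
    [evalA] to be linear, on WQSym. *)
Lemma lin_on_sum (W : lmodType K) (S : V -> Prop) (f : V -> W)
    (T : Type) (r : seq T) (c : T -> K) (F : T -> V) :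
  S 0 -> (forall a x y, S x -> S y -> S (a *: x + y)) ->
  (forall a x y, S x -> S y -> f (a *: x + y) = a *: f x + f y) ->
  (forall t, S (F t)) ->
  f (\sum_(t <- r) c t *: F t) = \sum_(t <- r) c t *: f (F t).
Proof.
move=> S0 SD fD SF; have f0 : f 0 = 0.
  by apply: (addrI (f 0)); rewrite addr0 -{1}[f 0]scale1r -fD // scale1r addr0.
have [//] : f (\sum_(t <- r) c t *: F t) = \sum_(t <- r) c t *: f (F t) /\
   S (\sum_(t <- r) c t *: F t).
elim: r => [|t r [IH Sr]]; first by rewrite !big_nil.
by rewrite !big_cons fD ?IH //; split=> //; apply: SD.
Qed.

End Span.

Lemma WQSym_of n (phi : packing n -> K) : WQSym K (WQ_of phi).
Proof. by apply: lin_span_sum => u _; apply: WQSym_P. Qed.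

Lemma evalA_sum (T : Type) (r : seq T) (c : T -> K) (F : T -> ncseq K a_alph) :
  (forall t, WQSym K (F t)) ->
  evalA (\sum_(t <- r) c t *: F t) = \sum_(t <- r) c t *: evalA (F t).
Proof.
move=> WF; apply: (@lin_on_sum _ _ (WQSym K)) => //.
- exact: lin_span0.
- by move=> a x y; apply: lin_spanP.
- by move=> a x y; apply: evalA_lin.
Qed.

Lemma evalA_of n (phi : packing n -> K) :
  evalA (WQ_of phi) = \sum_u phi u *: WQ_PA K (pword u).
Proof.
rewrite /WQ_of evalA_sum => [|u]; last exact: WQSym_P.
by apply: eq_bigr => u _; rewrite evalA_P ?packed_pword.
Qed.

Lemma nccoef_evalA_of n (phi : packing n -> K) N (w : n.-tuple 'I_N) :
  nccoef (evalA (WQ_of phi) N) w = signed_eval phi (tfun w).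
Proof.
rewrite evalA_of nccoef_seq_sum; apply: eq_bigr => u _.
by rewrite nccoef_seqZ nccoef_WQ_PA.
Qed.

Lemma homog_evalA_of n (phi : packing n -> K) : homog n (evalA (WQ_of phi)).
Proof.
apply/homogP => N w sw; rewrite evalA_of nccoef_seq_sum big1 // => u _.
rewrite nccoef_seqZ; have /homogP -> := @homog_WQ_PA n u; by rewrite ?mulr0.
Qed.

End Coefficients.

(** * Composition of linear substitutions *)

Section SubstitutionTheory.
Variable K : fieldType.

Lemma ncsubst0 (I J : choiceType) (L : I -> ncpoly K J) : ncsubst L 0 = 0.
Proof. by rewrite /ncsubst msupp0 big_seq_fset0. Qed.

Lemma prod_sum_tuple (n : nat) (J : finType) (F : 'I_n -> J -> K) :
  \prod_(q < n) \sum_(y : J) F q y = \sum_(v : n.-tuple J) \prod_(q < n) F q (tnth v q).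
Proof.
rewrite bigA_distr_bigA (reindex (fun v : n.-tuple J => finfun (tnth v))) /=.
  by apply: eq_bigr => v _; apply: eq_bigr => q _; rewrite ffunE.
exists (fun f : {ffun 'I_n -> J} => [tuple f i | i < n]) => v _.
  by apply: eq_from_tnth => q; rewrite tnth_mktuple ffunE.
by apply/ffunP => q; rewrite ffunE tnth_mktuple.
Qed.

Lemma nccoef_subst1 (I : finType) (J : choiceType) (L : I -> ncpoly K J) p y :
  linear_subst L ->
  nccoef (ncsubst L p) [:: y] = \sum_(x : I) nccoef p [:: x] * nccoef (L x) [:: y].
Proof.
move=> linL; rewrite (nccoef_subst_linear p [tuple y] linL).
rewrite (reindex (fun x : I => [tuple x])) /=; last first.
  exists (fun v : 1.-tuple I => thead v) => v _ //.
  by case/tupleP: v => x v; apply: val_inj; rewrite /= theadE (tuple0 v).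
by apply: eq_bigr => x _; rewrite big_ord1.
Qed.

Lemma linear_subst_comp (I J : finType) (H : choiceType) (L : I -> ncpoly K J)
    (M : J -> ncpoly K H) : linear_subst L -> linear_subst M ->
  linear_subst (fun i => ncsubst M (L i)).
Proof.
move=> linL linM i s s1; rewrite (nccoef_subst_linear _ (in_tuple s) linM).
by rewrite big1 // => v _; rewrite linL ?mul0r // size_tuple.
Qed.

Lemma ncsubst_comp (I J : finType) (H : choiceType) (L : I -> ncpoly K J)
    (M : J -> ncpoly K H) p : linear_subst L -> linear_subst M ->
  ncsubst M (ncsubst L p) = ncsubst (fun i => ncsubst M (L i)) p.
Proof.
move=> linL linM; apply: nccoefP => s.
rewrite (nccoef_subst_linear _ (in_tuple s) linM).
rewrite (nccoef_subst_linear _ (in_tuple s) (linear_subst_comp linL linM)).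
under eq_bigr => v _ do rewrite (nccoef_subst_linear _ v linL) mulr_suml.
rewrite exchange_big; apply: eq_bigr => v _ /=.
under [in RHS]eq_bigr => q _ do rewrite (nccoef_subst1 _ _ linM).
rewrite prod_sum_tuple mulr_sumr; apply: eq_bigr => y _.
by rewrite -mulrA big_split.
Qed.

Lemma eq_ncsubst (I J : choiceType) (L M : I -> ncpoly K J) p :
  L =1 M -> ncsubst L p = ncsubst M p.
Proof. by move=> /boolp.funext ->. Qed.

Lemma nccoef_subst_homog (I : finType) (J : choiceType) (L : I -> ncpoly K J) p n (s : seq J) :
  linear_subst L -> (forall w, size w != n -> nccoef p w = 0) -> size s != n ->
  nccoef (ncsubst L p) s = 0.
Proof.
move=> linL hp sn; rewrite (nccoef_subst_linear _ (in_tuple s) linL).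
by rewrite big1 // => v _; rewrite hp ?mul0r // size_tuple.
Qed.

Lemma linear_var (I : choiceType) (x : I) s : size s != 1%N ->
  nccoef (ncvar K x) s = 0.
Proof. by move=> s1; rewrite nccoef_var; case: (s =P _) s1 => // ->. Qed.

End SubstitutionTheory.

(** * Cancellation of equal neighbouring letters *)

Section Cancellation.
Variable K : numFieldType.

Lemma skip_subproof N (s : nat) (t : 'I_N) : ((if (t < s)%N then t : nat else t.+2) < N.+2)%N.
Proof. by have := ltn_ord t; case: ifP; lia. Qed.

(** The increasing injection that avoids [s] and [s.+1]. Jumping over two letters preserves parity,
    hence signs. *)
Definition skip N (s : nat) (t : 'I_N) : 'I_N.+2 := Ordinal (skip_subproof s t).

Lemma skip_inj N s : injective (@skip N s).
Proof.
move=> t t' /(congr1 val) /= H; apply/val_inj => /=; move: H.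
by case: ifP; case: ifP; lia.
Qed.

(** The weights do not distinguish [e] from [z]. Words are grouped by the set [R] of positions
    holding one of these letters; in a group with [R] nonempty, moving an extreme block from one
    letter to the other changes the sign. The words that remain are those avoiding both letters. *)
Lemma signed_eval_cancel n (phi : packing n -> K) N s (W : 'I_n -> 'I_N.+2 -> K) (e z : 'I_N.+2) :
  e = s :> nat -> z = s.+1 :> nat -> (forall q, W q e = W q z) ->
  \sum_(v : n.-tuple 'I_N.+2) signed_eval phi (tfun v) * \prod_q W q (tnth v q) =
  \sum_(v : n.-tuple 'I_N) signed_eval phi (tfun v) * \prod_q W q (skip s (tnth v q)).
Proof.
move=> es zs Wez.
pose used (v : n.-tuple 'I_N.+2) := [set q | (tnth v q == e) || (tnth v q == z)].
rewrite (bigID (fun v => used v == set0)) /= [X in _ + X](_ : _ = 0) ?addr0.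
  pose h (v : n.-tuple 'I_N) := [tuple skip s (tnth v q) | q < n].
  have hinj : injective h.
    move=> v v' H; apply: eq_from_tnth => q; apply: (@skip_inj _ s).
    by have := congr1 (fun t => tnth t q) H; rewrite !tnth_mktuple.
  transitivity (\sum_(v in [set h v | v : n.-tuple 'I_N])
     signed_eval phi (tfun v) * \prod_q W q (tnth v q)).
    apply: eq_bigl => v; apply/eqP/imsetP => [/setP used0|[v' _ ->]].
      have H q : exists t, skip s t = tnth v q :> 'I_N.+2.
        have := used0 q; rewrite !inE => /norP[/eqP ve /eqP vz].
        have lt := ltn_ord (tnth v q); have ltz := ltn_ord z.
        have ve' : (tnth v q : nat) <> s by move=> H; apply: ve; apply/val_inj; rewrite /= H.
        have vz' : (tnth v q : nat) <> s.+1 by move=> H; apply: vz; apply/val_inj; rewrite /= H.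
        have tN : ((if (tnth v q < s)%N then tnth v q : nat else (tnth v q).-2) < N)%N.
          by case: ifP; lia.
        by exists (Ordinal tN); apply/val_inj => /=; case: (ltnP (tnth v q) s) => /=; case: ifP; lia.
      have [t tE] := fin_all_exists H; exists [tuple t q | q < n] => //.
      by apply: eq_from_tnth => q; rewrite !tnth_mktuple tE.
    apply/setP => q; rewrite !inE tnth_mktuple -!val_eqE /= es zs.
    by apply/negbTE; case: ifP; lia.
  rewrite big_imset /=; last by move=> v v' _ _; apply: hinj.
  apply: eq_bigr => v _; congr (_ * _); last by apply: eq_bigr => q _; rewrite tnth_mktuple.
  apply: signed_eval_ext => [p q|q]; rewrite /tfun !tnth_mktuple /=.
    by do 2 case: ifP; lia.
  by case: ifP; rewrite //= negbK.
rewrite (partition_big used (fun R => R != set0)) //= big1 // => R R0.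
suff H (u : packing n) : \sum_(v | (used v != set0) && (used v == R))
    refcoef K u (tfun v) * \prod_q W q (tnth v q) = 0.
  under eq_bigr => v _ do rewrite /signed_eval mulr_suml.
  rewrite exchange_big big1 //= => u _.
  by under eq_bigr => v _ do rewrite -mulrA; rewrite -mulr_sumr H mulr0.
have [l [[p0 [up0 p0R]] Hl]] := block_level u (odd e) R0.
pose h (v : n.-tuple 'I_N.+2) :=
  [tuple (if u q == l then tperm e z (tnth v q) else tnth v q) | q < n].
have used_h v : used (h v) = used v.
  apply/setP => q; rewrite !inE tnth_mktuple; case: ifP => // _.
  by rewrite !(canF_eq (tpermK e z)) tpermL tpermR orbC.
apply: (sum_sign_involution (h := h)) => v.
- move=> _; apply: eq_from_tnth => q; rewrite !tnth_mktuple.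
  by case: (u q == l); rewrite // tpermK.
- by rewrite used_h.
case/andP => _ /eqP vR.
have ez : (e < z)%N by rewrite es zs.
have oez : odd e != odd z by rewrite es zs /=; case: (odd s).
have vE q : (tfun v q == e) || (tfun v q == z) = (q \in R).
  by rewrite -vR inE /tfun.
have tv : togglable u e z l (tfun v).
  split.
  - by move=> p; rewrite es zs; lia.
  - by exists p0; rewrite up0 vE.
  - by move=> p; rewrite vE; apply: Hl.
have -> : \prod_q W q (tnth (h v) q) = \prod_q W q (tnth v q).
  apply: eq_bigr => q _; rewrite tnth_mktuple; case: ifP => // _.
  by case: tpermP => [->|->|].
have -> : tfun (h v) = toggle u e z l (tfun v).
  apply: boolp.funext => q; rewrite /tfun /toggle tnth_mktuple.
  case: ifP => // _; rewrite !val_eqE.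
  by case: tpermP => [->|->|/eqP/negbTE -> /eqP/negbTE ->]; rewrite ?eqxx //; case: eqP => // ->.
by rewrite (refcoef_toggle K (@pfun_lt _ u) ez oez tv) mulNr.
Qed.

(** Two neighbouring letters with the same value disappear from [F(A)], as one of them is negative.
    Stability and the functional equations are all instances of this. *)
Lemma evalA_cancel n (phi : packing n -> K) N s (J : finType) (L : 'I_N.+2 -> ncpoly K J) (e z : 'I_N.+2) :
  linear_subst L -> e = s :> nat -> z = s.+1 :> nat -> L e = L z ->
  ncsubst L (evalA (WQ_of phi) N.+2) =
  ncsubst (fun t => L (skip s t)) (evalA (WQ_of phi) N).
Proof.
move=> linL es zs Lez; apply: nccoefP => w.
have linL' : linear_subst (fun t => L (skip s t)) by move=> t; apply: linL.
have /homogP hE := @homog_evalA_of K n phi.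
have [wn|wn] := eqVneq (size w) n; last first.
  rewrite (nccoef_subst_homog linL (hE _)) //.
  by rewrite (nccoef_subst_homog linL' (hE _)).
case: n / wn phi hE => psi hE.
rewrite (nccoef_subst_linear _ (in_tuple w) linL).
rewrite (nccoef_subst_linear _ (in_tuple w) linL').
under eq_bigr => v _ do rewrite nccoef_evalA_of.
under [in RHS]eq_bigr => v _ do rewrite nccoef_evalA_of.
apply: (signed_eval_cancel psi
  (W := fun q t => nccoef (L t) [:: tnth (in_tuple w) q]) es zs) => q.
by rewrite Lez.
Qed.

End Cancellation.

(** * Phi and the functional equations *)

Section PhiCoefficients.
Variable K : numFieldType.

(** With [t] and [j] counted from 0, the step from [t = j.*2] to [j.*2.+1] subtracts [b_j], and the
    next step subtracts [d_j]. Killing one of these variables makes the two letters on either side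
    of the step equal. *)
Definition a_coef (t : nat) m (y : bd_alph m) : K :=
  match y with inl j => - (j.*2.+1 <= t)%:R | inr j => (t < j.*2.+2)%:R end.

Lemma linear_bvar m (j : 'I_m) s : size s != 1%N -> nccoef (bvar K j) s = 0.
Proof. exact: linear_var. Qed.

Lemma linear_dvar m (j : 'I_m) s : size s != 1%N -> nccoef (dvar K j) s = 0.
Proof. exact: linear_var. Qed.

Lemma nccoef_bvar m (j : 'I_m) (y : bd_alph m) :
  nccoef (bvar K j) [:: y] = (y == inl j)%:R.
Proof. by rewrite nccoef_var eqseq_cons andbT. Qed.

Lemma nccoef_dvar m (j : 'I_m) (y : bd_alph m) :
  nccoef (dvar K j) [:: y] = (y == inr j)%:R.
Proof. by rewrite nccoef_var eqseq_cons andbT. Qed.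

Lemma nccoef_sumB m (P Q : pred 'I_m) (F G : 'I_m -> ncpoly K (bd_alph m)) s :
  nccoef (\sum_(j < m | P j) F j - \sum_(j < m | Q j) G j) s =
  \sum_(j < m | P j) nccoef (F j) s - \sum_(j < m | Q j) nccoef (G j) s.
Proof. by rewrite nccoefD nccoefN; congr (_ - _); rewrite nccoef_sum. Qed.

Lemma a_value_linear m t s : size s != 1%N -> nccoef (a_value K m t) s = 0.
Proof.
move=> s1; rewrite /a_value nccoef_sumB.
rewrite [X in X - _]big1 => [|j _]; last exact: linear_dvar.
by rewrite [X in _ - X]big1 ?subr0 // => j _; exact: linear_bvar.
Qed.

Lemma linear_a_value m t : linear_subst (fun k : 'I_t => a_value K m k.+1).
Proof. by move=> k s; apply: a_value_linear. Qed.

Lemma nccoef_dvar_bvar m (P Q : pred 'I_m) (y : bd_alph m) :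
  nccoef (\sum_(j < m | P j) dvar K j - \sum_(j < m | Q j) bvar K j) [:: y] =
  match y with inl j => - (Q j)%:R | inr j => (P j)%:R end.
Proof.
rewrite nccoef_sumB; case: y => k.
  rewrite [X in X - _]big1 => [|j _]; last by rewrite nccoef_dvar.
  rewrite sub0r; congr (- _); rewrite big_mkcond (bigD1 k) //= [X in _ + X]big1.
    by rewrite addr0 nccoef_bvar eqxx; case: (Q k).
  move=> i ik; case: (Q i); rewrite // nccoef_bvar.
  by case: eqP => // -[e]; rewrite e eqxx in ik.
rewrite [X in _ - X]big1 => [|j _]; last by rewrite nccoef_bvar.
rewrite subr0 big_mkcond (bigD1 k) //= [X in _ + X]big1.
  by rewrite addr0 nccoef_dvar eqxx; case: (P k).
move=> i ik; case: (P i); rewrite // nccoef_dvar.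
by case: eqP => // -[e]; rewrite e eqxx in ik.
Qed.

Lemma nccoef_a_value m t (y : bd_alph m) :
  nccoef (a_value K m t.+1) [:: y] = a_coef t y.
Proof.
rewrite /a_value nccoef_dvar_bvar; case: y => j; rewrite /a_coef.
  by congr (- _%:R); lia.
by congr _%:R; case: ifP; lia.
Qed.

Lemma linear_kill_d m (i : 'I_m) : linear_subst (kill_d K i).
Proof.
move=> [j|j] s s1 /=; first exact: linear_bvar.
by case: ifP => _; rewrite ?nccoef0 ?linear_dvar.
Qed.

Lemma linear_kill_b m (i : 'I_m) : linear_subst (kill_b K i).
Proof.
move=> [j|j] s s1 /=; last exact: linear_dvar.
by case: ifP => _; rewrite ?nccoef0 ?linear_bvar.
Qed.

Lemma linear_merge_b m (i : 'I_m.+1) : linear_subst (merge_b K i).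
Proof.
move=> [j|j] s s1 /=; rewrite ?linear_dvar // nccoefD linear_bvar // addr0.
by case: ifP; rewrite ?linear_bvar ?nccoef0.
Qed.

Lemma linear_merge_d m (i : 'I_m.+1) : linear_subst (merge_d K i).
Proof.
move=> [j|j] s s1 /=; rewrite ?linear_bvar // nccoefD linear_dvar // add0r.
by case: ifP; rewrite ?linear_dvar ?nccoef0.
Qed.

Lemma linear_bd_restrict m : linear_subst (@bd_restrict K m).
Proof.
by move=> [j|j] s s1 /=; case: (unlift _ _) => [k|];
  rewrite ?nccoef0 //; [apply: linear_bvar | apply: linear_dvar].
Qed.

Lemma nccoef_kill_d m (i : 'I_m) (x y : bd_alph m) :
  nccoef (kill_d K i x) [:: y] = ((x == y) && (y != inr i))%:R.
Proof.
case: x => j /=; first by rewrite nccoef_bvar eq_sym; case: eqP => // <-.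
case: eqP => [->|ne]; first by rewrite nccoef0; case: eqP => // <-; rewrite eqxx.
rewrite nccoef_dvar eq_sym; case: eqP => // <- /=.
by case: eqP => // -[].
Qed.

Lemma nccoef_kill_b m (i : 'I_m) (x y : bd_alph m) :
  nccoef (kill_b K i x) [:: y] = ((x == y) && (y != inl i))%:R.
Proof.
case: x => j /=; last by rewrite nccoef_dvar eq_sym; case: eqP => // <-.
case: eqP => [->|ne]; first by rewrite nccoef0; case: eqP => // <-; rewrite eqxx.
rewrite nccoef_bvar eq_sym; case: eqP => // <- /=.
by case: eqP => // -[].
Qed.

Lemma sum_pick (T : finType) (F : T -> K) (y : T) (b : bool) :
  \sum_x F x * ((x == y) && b)%:R = if b then F y else 0.
Proof.
rewrite (bigD1 y) //= eqxx big1 ?addr0.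
  by case: b; rewrite /= ?mulr1 ?mulr0.
by move=> x /negbTE ->; rewrite mulr0.
Qed.

Lemma nccoef_a_kill_d m (i : 'I_m) t (y : bd_alph m) :
  nccoef (ncsubst (kill_d K i) (a_value K m t.+1)) [:: y] =
  if y != inr i then a_coef t y else 0.
Proof.
rewrite nccoef_subst1; last exact: linear_kill_d.
under eq_bigr => x _ do rewrite nccoef_a_value nccoef_kill_d.
exact: sum_pick.
Qed.

Lemma nccoef_a_kill_b m (i : 'I_m) t (y : bd_alph m) :
  nccoef (ncsubst (kill_b K i) (a_value K m t.+1)) [:: y] =
  if y != inl i then a_coef t y else 0.
Proof.
rewrite nccoef_subst1; last exact: linear_kill_b.
under eq_bigr => x _ do rewrite nccoef_a_value nccoef_kill_b.
exact: sum_pick.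
Qed.

Lemma sum_lift m (i k : 'I_m.+1) (F : nat -> K) :
  \sum_(j < m) F j * (k == lift i j)%:R =
  if k == i then 0 else F (if (k < i)%N then k : nat else k.-1).
Proof.
case: (unliftP i k) => [j0 ->|->]; last first.
  rewrite eqxx big1 // => j _; rewrite (_ : (i == _) = false) ?mulr0 //.
  by apply/negbTE; rewrite neq_lift.
rewrite eq_sym (negbTE (neq_lift _ _)) (bigD1 j0) //= eqxx mulr1 big1 ?addr0.
  by congr F; rewrite /= /bump; case: leqP; lia.
move=> j jj0; rewrite (inj_eq lift_inj) eq_sym (negbTE jj0) mulr0 //.
Qed.

Lemma sum_slot m (F : nat -> K) (i : nat) (b : bool) :
  \sum_(j < m) F j * ((j == i :> nat) && b)%:R = if b && (i < m)%N then F i else 0.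
Proof.
case: (ltnP i m) => im; last first.
  rewrite andbF big1 // => j _; rewrite (_ : (_ == _) = false) ?mulr0 //.
  by have := ltn_ord j; lia.
rewrite (bigD1 (Ordinal im)) //= eqxx big1 ?addr0.
  by case: b; rewrite /= ?mulr1 ?mulr0.
move=> j ji; rewrite (_ : (_ == _) = false) ?mulr0 //.
by apply: contraNF ji => /eqP e; apply/eqP/val_inj.
Qed.

(** Killing [d_i] makes the letters [i.*2.+1] and [i.*2.+2] equal. Once they are deleted, [b_i] and
    [b_(i+1)] are subtracted at the same step, so they enter only through their sum.
    [nccoef_a_merge_d] is the same for [b_i], with the letters [i.*2] and [i.*2.+1]. *)
Lemma nccoef_a_merge_b m (i : 'I_m.+1) (t : 'I_m.*2.+1) (y : bd_alph m.+1) :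
  nccoef (ncsubst (merge_b K i) (a_value K m t.+1)) [:: y] =
  if y != inr i then a_coef (skip i.*2.+1 t) y else 0.
Proof.
rewrite nccoef_subst1; last exact: linear_merge_b.
under eq_bigr => x _ do rewrite nccoef_a_value.
rewrite big_sumType /=; have := ltn_ord t; have := ltn_ord i => im tm.
case: y => k.
  rewrite [X in _ + X]big1 ?addr0; last first.
    by move=> j _; rewrite nccoef_dvar mulr0.
  rewrite (eq_bigr (fun j : 'I_m =>
     - (j.*2.+1 <= t)%:R * ((j == i :> nat) && (k == i))%:R
     + - (j.*2.+1 <= t)%:R * (k == lift i j)%:R)); last first.
    move=> j _; rewrite -mulrDr nccoefD nccoef_bvar; congr (_ * (_ + _)).
    by case: eqP => _; rewrite ?nccoef_bvar ?nccoef0.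
  rewrite big_split /= (sum_slot m (fun j => - (j.*2.+1 <= t)%:R) i).
  rewrite (sum_lift _ _ (fun j => - (j.*2.+1 <= t)%:R)) /=.
  case: (eqVneq k i) => [->|ki] /=.
    rewrite addr0.
    (* For the last index, [i = m], both sides are false since [t <= m.*2]: the last [b] is dropped
       instead of merged. *)
    have -> : (i.*2 < (if (t < i.*2.+1)%N then t : nat else t.+2))%N =
              (i < m)%N && (i.*2 < t)%N by case: ifP; lia.
    by case: (i < m)%N; rewrite //= oppr0.
  rewrite add0r; congr (- _%:R).
  have : (k : nat) <> i by move=> e; case/eqP: ki; apply/val_inj.
  by case: ifP; case: ifP; lia.
rewrite big1 ?add0r; last first.
  move=> j _; rewrite nccoefD nccoef_bvar addr0.
  by case: ifP => _; rewrite ?nccoef_bvar ?nccoef0 mulr0.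
under eq_bigr => j _ do rewrite nccoef_dvar.
rewrite (sum_lift i k (fun j => (t < j.*2.+2)%:R)) /=.
have -> : (inr k != inr i :> bd_alph m.+1) = (k != i) by [].
case: (eqVneq k i) => //= ki; congr (_%:R).
have : (k : nat) <> i by move=> e; case/eqP: ki; apply/val_inj.
by case: ifP; case: ifP; lia.
Qed.

Lemma nccoef_a_merge_d m (i : 'I_m.+1) (t : 'I_m.*2.+1) (y : bd_alph m.+1) :
  nccoef (ncsubst (merge_d K i) (a_value K m t.+1)) [:: y] =
  if y != inl i then a_coef (skip i.*2 t) y else 0.
Proof.
rewrite nccoef_subst1; last exact: linear_merge_d.
under eq_bigr => x _ do rewrite nccoef_a_value.
rewrite big_sumType /=; have := ltn_ord t; have := ltn_ord i => im tm.
case: y => k.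
  rewrite [X in _ + X]big1 ?addr0; last first.
    move=> j _; rewrite nccoefD nccoef_dvar add0r.
    by case: ifP => _; rewrite ?nccoef_dvar ?nccoef0 mulr0.
  under eq_bigr => j _ do rewrite nccoef_bvar.
  rewrite (sum_lift i k (fun j => - (j.*2.+1 <= t)%:R)) /=.
  have -> : (inl k != inl i :> bd_alph m.+1) = (k != i) by [].
  case: (eqVneq k i) => //= ki; congr (- _%:R).
  have : (k : nat) <> i by move=> e; case/eqP: ki; apply/val_inj.
  by case: ifP; case: ifP; lia.
rewrite big1 ?add0r; last by move=> j _; rewrite nccoef_bvar mulr0.
rewrite (eq_bigr (fun j : 'I_m =>
   (t < j.*2.+2)%:R * ((j == i.-1 :> nat) && ((0 < i)%N && (k == i)))%:R
   + (t < j.*2.+2)%:R * (k == lift i j)%:R)); last first.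
  move=> j _; rewrite -mulrDr nccoefD nccoef_dvar addrC; congr (_ * (_ + _)).
  have -> : (j.+1 == i) = (j == i.-1 :> nat) && (0 < i)%N by lia.
  rewrite andbA; case: ifP => _; rewrite ?nccoef0 // nccoef_dvar.
  by [].
rewrite big_split /= (sum_slot m (fun j => (t < j.*2.+2)%:R) i.-1).
rewrite (sum_lift _ _ (fun j => (t < j.*2.+2)%:R)) /=.
case: (eqVneq k i) => [->|ki] /=.
  rewrite addr0 andbT; case: (posnP i) => i0 /=; last first.
    by rewrite ifT; [congr (_%:R); case: ifP; lia | lia].
  by rewrite i0.
rewrite andbF add0r; congr (_%:R).
have : (k : nat) <> i by move=> e; case/eqP: ki; apply/val_inj.
by case: ifP; case: ifP; lia.
Qed.

End PhiCoefficients.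

(** * Solutions of the functional equations and their coordinates *)

Section PhiSolutions.
Variable K : numFieldType.

Lemma eq_linear_form (J : choiceType) (p q : ncpoly K J) :
  (forall s, size s != 1%N -> nccoef p s = 0) ->
  (forall s, size s != 1%N -> nccoef q s = 0) ->
  (forall y, nccoef p [:: y] = nccoef q [:: y]) -> p = q.
Proof.
move=> linp linq H; apply: nccoefP => -[|y [|z s]]; rewrite ?H //.
  by rewrite linp // linq.
by rewrite linp // linq.
Qed.

Lemma subst_a_linear m (J : choiceType) (L : bd_alph m -> ncpoly K J) t :
  linear_subst L -> forall s, size s != 1%N -> nccoef (ncsubst L (a_value K m t)) s = 0.
Proof.
by move=> linL s; apply: nccoef_subst_homog => // w; apply: a_value_linear.
Qed.

Lemma Phi_cancel n (phi : packing n -> K) m (L : bd_alph m.+1 -> ncpoly K (bd_alph m.+1))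
    (M : bd_alph m -> ncpoly K (bd_alph m.+1)) s :
  linear_subst L -> linear_subst M -> (s.+1 < m.*2.+3)%N ->
  (forall y, nccoef (ncsubst L (a_value K m.+1 s.+1)) [:: y] =
             nccoef (ncsubst L (a_value K m.+1 s.+2)) [:: y]) ->
  (forall (t : 'I_m.*2.+1) y,
     nccoef (ncsubst L (a_value K m.+1 (skip s t).+1)) [:: y] =
     nccoef (ncsubst M (a_value K m t.+1)) [:: y]) ->
  ncsubst L (Phi (evalA (WQ_of phi)) m.+1) =
  ncsubst M (Phi (evalA (WQ_of phi)) m).
Proof.
move=> linL linM sm H1 H2; rewrite /Phi.
rewrite !ncsubst_comp //; try exact: linear_a_value.
pose e := @Ordinal m.*2.+3 s (ltnW sm); pose z := @Ordinal m.*2.+3 s.+1 sm.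
have linC : linear_subst (fun t : 'I_m.*2.+3 => ncsubst L (a_value K m.+1 t.+1)).
  by move=> t; apply: subst_a_linear.
have Lez : ncsubst L (a_value K m.+1 e.+1) = ncsubst L (a_value K m.+1 z.+1).
  by apply: eq_linear_form; try exact: subst_a_linear.
etransitivity; first exact: (@evalA_cancel K n phi m.*2.+1 s _ _ e z linC).
apply: eq_ncsubst => t; apply: eq_linear_form; try exact: subst_a_linear.
by move=> y; apply: H2.
Qed.

Definition bd_widen m (y : bd_alph m) : bd_alph m.+1 :=
  match y with inl k => inl (lift ord_max k) | inr k => inr (lift ord_max k) end.

Lemma nccoef_bd_restrict m (x : bd_alph m.+1) (y : bd_alph m) :
  nccoef (@bd_restrict K m x) [:: y] = (x == bd_widen y)%:R.
Proof.
have E (k j : 'I_m) : (lift ord_max k == lift ord_max j) = (k == j).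
  by rewrite (inj_eq lift_inj).
have N (k : 'I_m) : (ord_max == lift ord_max k) = false.
  by apply/negbTE; rewrite neq_lift.
case: x => j; rewrite /bd_restrict; case: unliftP => [j' ->|->]; case: y => k.
- by rewrite nccoef_bvar -[LHS]/((k == j')%:R) -E eq_sym.
- by rewrite nccoef_bvar.
- by rewrite nccoef0 -[RHS]/((ord_max == lift ord_max k)%:R) N.
- by rewrite nccoef0.
- by rewrite nccoef_dvar.
- by rewrite nccoef_dvar -[LHS]/((k == j')%:R) -E eq_sym.
- by rewrite nccoef0.
- by rewrite nccoef0 -[RHS]/((ord_max == lift ord_max k)%:R) N.
Qed.

Lemma nccoef_a_restrict m t (y : bd_alph m) :
  nccoef (ncsubst (@bd_restrict K m) (a_value K m.+1 t.+1)) [:: y] = a_coef K t y.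
Proof.
rewrite nccoef_subst1; last exact: linear_bd_restrict.
under eq_bigr => x _ do rewrite nccoef_a_value nccoef_bd_restrict -[_ == _]andbT.
by rewrite sum_pick; case: y => k; rewrite /= /bump [(m <= k)%N]leqNgt (ltn_ord k).
Qed.

Lemma homog_Phi_of n (phi : packing n -> K) : homog n (Phi (evalA (WQ_of phi))).
Proof.
have /homogP hE : homog n (evalA (WQ_of phi)) := @homog_evalA_of K n phi.
apply/homogP => m s sn; rewrite /Phi.
by rewrite (nccoef_subst_homog (@linear_a_value K m _) (hE _)).
Qed.

Lemma skip_id N s (t : 'I_N) : (N <= s)%N -> skip s t = t :> nat.
Proof. by move=> Ns; rewrite /= (leq_trans (ltn_ord t) Ns). Qed.

Lemma stable_Phi_of n (phi : packing n -> K) :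
  stable (@bd_restrict K) (Phi (evalA (WQ_of phi))).
Proof.
split; first by exists n => m w /(@homog_Phi_of n phi) ->.
move=> m; rewrite /Phi ncsubst_comp; try exact: linear_a_value; try exact: linear_bd_restrict.
have lin : linear_subst (fun t : 'I_m.*2.+3 => ncsubst (@bd_restrict K m) (a_value K m.+1 t.+1)).
  by move=> t; apply: subst_a_linear; apply: linear_bd_restrict.
have l1 : (m.*2.+1 < m.*2.+3)%N by lia.
have l2 : (m.*2.+2 < m.*2.+3)%N by lia.
(* When the last [b] and [d] are killed, the last three letters coincide. Deleting the final two
   leaves all other indices unchanged. *)
pose e := Ordinal l1; pose z := Ordinal l2.
have Lez : ncsubst (@bd_restrict K m) (a_value K m.+1 e.+1) =
           ncsubst (@bd_restrict K m) (a_value K m.+1 z.+1).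
  apply: eq_linear_form; try by apply: subst_a_linear; apply: linear_bd_restrict.
  move=> y; apply: etrans (nccoef_a_restrict _ _) (etrans _ (esym (nccoef_a_restrict _ _))).
  case: y => j; rewrite /a_coef /=;
  have := ltn_ord j; [move=> jm; congr (- _%:R)|move=> jm; congr _%:R]; lia.
etransitivity; first exact: (@evalA_cancel K n phi m.*2.+1 m.*2.+1 _ _ e z lin).
apply: eq_ncsubst => t; apply: eq_linear_form.
- by apply: subst_a_linear; apply: linear_bd_restrict.
- by move=> s; apply: a_value_linear.
- by move=> y; rewrite nccoef_a_restrict nccoef_a_value skip_id.
Qed.

Lemma Phi_of_sol n (phi : packing n -> K) : SolNC' K (Phi (evalA (WQ_of phi))).
Proof.
split; first exact: stable_Phi_of.
move=> m i; have im := ltn_ord i; split.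
  apply: (@Phi_cancel _ _ _ _ _ i.*2.+1); try exact: linear_kill_d; try exact: linear_merge_b.
  - by lia.
  - move=> y; apply: etrans (nccoef_a_kill_d _ _ _ _) (etrans _ (esym (nccoef_a_kill_d _ _ _ _))).
    case: eqP => //= yi; rewrite /a_coef.
    case: y yi => j yi; first by congr (- _%:R); lia.
    have : (j : nat) <> i by move=> e; apply: yi; congr inr; apply/val_inj.
    by move=> ji; congr (_%:R); lia.
  - by move=> t y; rewrite nccoef_a_kill_d nccoef_a_merge_b.
apply: (@Phi_cancel _ _ _ _ _ i.*2); try exact: linear_kill_b; try exact: linear_merge_d.
- by lia.
- move=> y; apply: etrans (nccoef_a_kill_b _ _ _ _) (etrans _ (esym (nccoef_a_kill_b _ _ _ _))).
    case: eqP => //= yi; rewrite /a_coef.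
  case: y yi => j yi; last by congr (_%:R); lia.
  have : (j : nat) <> i by move=> e; apply: yi; congr inl; apply/val_inj.
  by move=> ji; congr (- _%:R); lia.
- by move=> t y; rewrite nccoef_a_kill_b nccoef_a_merge_d.
Qed.

Lemma nccoef_kill m (L : bd_alph m -> ncpoly K (bd_alph m)) (x0 : bd_alph m) p s :
  linear_subst L ->
  (forall x y, nccoef (L x) [:: y] = ((x == y) && (y != x0))%:R) -> x0 \notin s ->
  nccoef (ncsubst L p) s = nccoef p s.
Proof.
move=> linL HL x0s; rewrite (nccoef_subst_linear p (in_tuple s) linL).
have E (v : (size s).-tuple (bd_alph m)) :
    \prod_(q < size s) nccoef (L (tnth v q)) [:: tnth (in_tuple s) q] =
    (v == in_tuple s)%:R.
  case: eqP => [->|ne].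
    rewrite big1 // => q _; rewrite HL eqxx /=; case: eqP => // e.
    by case/negP: x0s; rewrite -e; apply: mem_tnth.
  have [q Hq] : exists q, tnth v q != tnth (in_tuple s) q.
    apply/existsP; rewrite -negb_forall; apply/negP => /forallP H; apply: ne.
    by apply: eq_from_tnth => q; apply/eqP.
  by rewrite (bigD1 q) //= HL (negbTE Hq) mul0r.
rewrite (bigD1 (in_tuple s)) //= E eqxx mulr1 [X in _ + X]big1 ?addr0 //.
by move=> v /negbTE vs; rewrite E vs mulr0.
Qed.

(* A solution is determined by its coefficients on the words in which all the
   letters occur: the others are read off a smaller component. *)
Lemma SolNC'_full (h : ncseq K bd_alph) : SolNC' K h ->
  (forall m (s : seq (bd_alph m)), (forall x, x \in s) -> nccoef (h m) s = 0) ->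
  h = 0.
Proof.
case=> _ Hh full; apply: boolp.functional_extensionality_dep => m.
rewrite -[RHS]/(0 : ncpoly K (bd_alph m)).
elim: m => [|m IH]; apply: nccoefP => s; rewrite nccoef0.
  by apply: full => -[[]|[]].
have [/forallP Hs|] := boolP [forall x, x \in s]; first exact: full.
rewrite negb_forall => /existsP[[i|i] xs]; have [Hd Hb] := Hh m i.
  rewrite -(nccoef_kill _ (@linear_kill_b K _ i) (@nccoef_kill_b K _ i) xs).
  by rewrite Hb IH ncsubst0 nccoef0.
rewrite -(nccoef_kill _ (@linear_kill_d K _ i) (@nccoef_kill_d K _ i) xs).
by rewrite Hd IH ncsubst0 nccoef0.
Qed.

(** The order b_1, d_1, b_2, d_2, ... of the variables. It turns a word in which all [2m] variables
    occur into a packed word with [2m] letters. *)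
Definition bd_code m (y : bd_alph m) : nat :=
  match y with inl j => j.*2 | inr j => j.*2.+1 end.

Lemma bd_code_inj m : injective (@bd_code m).
Proof.
move=> [i|i] [j|j] /= e; try (by exfalso; lia);
  [congr inl|congr inr]; apply/val_inj => /=; lia.
Qed.

Lemma bd_code_lt m (y : bd_alph m) : (bd_code y < m.*2)%N.
Proof. by case: y => j; rewrite /bd_code; have := ltn_ord j; lia. Qed.

Lemma bd_codeP m k : (k < m.*2)%N -> exists y : bd_alph m, bd_code y = k.
Proof.
move=> km; have hm : (k./2 < m)%N by lia.
case: (boolP (odd k)) => ok; [exists (inr (Ordinal hm)) | exists (inl (Ordinal hm))] => /=; lia.
Qed.

(** As [bd_code] is injective, the sum has at most one term; it is 0 if [f] is not the code of a
    word. *)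
Definition word_coef n m (f : 'I_n -> nat) (h : ncseq K bd_alph) : K :=
  \sum_(v : n.-tuple (bd_alph m) | [forall q, bd_code (tnth v q) == f q])
     nccoef (h m) v.

Definition full_coef n (u : packing n) := word_coef (nletters u)./2 u.

Lemma SolNC'_full_coef n (h : ncseq K bd_alph) : SolNC' K h -> homog n h ->
  (forall u : packing n, ~~ odd (nletters u) -> full_coef u h = 0) -> h = 0.
Proof.
move=> Sh /homogP hn H; apply: SolNC'_full => // m s full.
have [sn|/hn //] := eqVneq (size s) n.
move: hn H; case: n / sn => hn H; set t := in_tuple s.
pose f q := bd_code (tnth t q).
have fP k : (k < m.*2)%N -> exists q, f q = k.
  move=> /bd_codeP[y yk]; have /tnthP[q yq] : y \in t := full y.
  by exists q; rewrite /f -yq.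
have fu : packf f =1 f.
  apply: gapless_inj; [exact: packing_gapless | | exact: same_order_packf].
  by move=> p j jp; apply: fP; apply: ltn_trans jp (bd_code_lt _).
have rE : nletters (packf f) = m.*2.
  apply/eqP; rewrite eqn_leq; apply/andP; split.
    by apply/bigmax_leqP => p _; rewrite fu bd_code_lt.
  have [m0|m0] := posnP m; first by rewrite {1}m0.
  have [|q fq] := fP m.*2.-1; first by lia.
  by have := ltn_nletters (packf f) q; rewrite fu fq; lia.
have := H (packf f); rewrite rE odd_double => /(_ isT).
rewrite /full_coef /word_coef rE doubleK (bigD1 t) /=; last first.
  by apply/forallP => q; rewrite fu.
rewrite [X in _ + X]big1 ?addr0 // => v /andP[/forallP vE /negP vt].
case: vt; apply/eqP/eq_from_tnth => q; apply: bd_code_inj.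
by rewrite (eqP (vE q)) fu.
Qed.

(* The substitution specializing the b and d to the virtual alphabet
   0, y_1, 0, y_2, ..., 0, y_n, y_1 + ... + y_n, on which P_1 vanishes. *)
Definition theta n (x : bd_alph n) : ncpoly K 'I_n :=
  match x with
  | inl i => - ncvar K i
  | inr i => ncvar K i - (if i.+1 == n then \sum_(k < n) ncvar K k else 0)
  end.

Lemma linear_theta n : linear_subst (@theta n).
Proof.
move=> [i|i] s s1; rewrite /theta.
  by rewrite nccoefN linear_var ?oppr0.
rewrite nccoefD linear_var // add0r nccoefN; case: ifP => _; rewrite ?nccoef0 ?oppr0 //.
by rewrite nccoef_sum big1 ?oppr0 // => k _; rewrite linear_var.
Qed.

Lemma nccoef_theta n (x : bd_alph n) (k : 'I_n) : nccoef (theta x) [:: k] =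
  match x with
  | inl i => - (i == k)%:R
  | inr i => (i == k)%:R - (i.+1 == n)%:R
  end.
Proof.
have V (i : 'I_n) : nccoef (ncvar K i) [:: k] = (i == k)%:R.
  by rewrite nccoef_var eqseq_cons andbT eq_sym.
have S (F : 'I_n -> ncpoly K 'I_n) s :
    nccoef (\sum_(j < n) F j) s = \sum_(j < n) nccoef (F j) s.
  by rewrite nccoef_sum.
case: x => i; rewrite /theta; first by rewrite nccoefN V.
rewrite nccoefD nccoefN V; congr (_ - _).
case: ifP => _; last by rewrite nccoef0.
rewrite S; transitivity (\sum_(j < n) 1 * ((j == k) && true)%:R : K).
  by apply: eq_bigr => j _; rewrite V andbT mul1r.
by rewrite sum_pick.
Qed.

(** The values of [theta] are the differences of consecutive letters of the virtual alphabet: 0 -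
    y_i for a [b] and y_i - 0 for a [d], except that the last [d] is followed by the letter y_1 +
    ... + y_n. *)
Lemma nccoef_theta_a n (t : 'I_n.*2.+1) (k : 'I_n) :
  nccoef (ncsubst (@theta n) (a_value K n t.+1)) [:: k] =
  (t == k.*2.+1 :> nat)%:R + (t == n.*2 :> nat)%:R.
Proof.
rewrite nccoef_subst1; last exact: linear_theta.
under eq_bigr => x _ do rewrite nccoef_a_value nccoef_theta.
rewrite big_sumType /= (bigD1 k) //= eqxx mulrN1 opprK.
rewrite [X in _ + X + _]big1 ?addr0; last first.
  by move=> i /negbTE ik; rewrite ik oppr0 mulr0.
have nk := ltn_ord k; have tn := ltn_ord t.
rewrite (eq_bigr (fun i : 'I_n => (t < i.*2.+2)%:R * ((i == k :> nat) && true)%:R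
    - (t < i.*2.+2)%:R * ((i == n.-1 :> nat) && true)%:R)); last first.
  move=> i _; rewrite -mulrBr !andbT; congr (_ * (_ - _%:R)).
  by have := ltn_ord i; lia.
rewrite sumrB (sum_slot n (fun i => (t < i.*2.+2)%:R : K) k).
rewrite (sum_slot n (fun i => (t < i.*2.+2)%:R : K) n.-1) nk /=.
have -> : (n.-1 < n)%N by lia.
have -> : (t < n.-1.*2.+2)%N = ~~ (t == n.*2 :> nat) by lia.
have [tk|[tk|tk]] : (t < k.*2.+1 \/ k.*2.+1 < t \/ t = k.*2.+1 :> nat)%N by lia.
- have -> : (k.*2 < t)%N = false by lia.
  have -> : (t < k.*2.+2)%N by lia.
  have -> : (t == n.*2 :> nat) = false by lia.
  have -> : (t == k.*2.+1 :> nat) = false by lia.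
  by rewrite /= add0r subrr addr0.
- have -> : (k.*2 < t)%N by lia.
  have -> : (t < k.*2.+2)%N = false by lia.
  have -> : (t == k.*2.+1 :> nat) = false by lia.
  by case: (t == n.*2 :> nat); rewrite /= ?add0r ?subr0 ?oppr0 ?addr0 ?subrr.
- rewrite tk; have -> : (k.*2.+1 == n.*2) = false by lia.
  by rewrite eqxx ltnSn leqnn /= subrr.
Qed.

(** When the product is expanded, every position takes either its own positive letter or the last
    negative letter, whose value contains every y; [R] records the latter choice. *)
Lemma sum_signed_eval_split n (phi : packing n -> K) (w : n.-tuple 'I_n) :
  \sum_(R : {set 'I_n}) signed_eval phi (split_word (tfun w) R n) =
  \sum_(v : n.-tuple 'I_n.*2.+1) signed_eval phi (tfun v) *
    \prod_q (((tnth v q == (tnth w q).*2.+1 :> nat))%:R + (tnth v q == n.*2 :> nat)%:R).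
Proof.
pose X (R : {set 'I_n}) q := split_word (tfun w) R n q.
have Xlt R q : (X R q < n.*2.+1)%N.
  rewrite /X /split_word; case: ifP => _ //.
  by have := ltn_ord (tnth w q); rewrite /tfun /=; lia.
pose x R : n.-tuple 'I_n.*2.+1 := [tuple Ordinal (Xlt R q) | q < n].
have xE R : tfun (x R) = split_word (tfun w) R n.
  by apply: boolp.funext => q; rewrite /tfun tnth_mktuple.
pose U (v : n.-tuple 'I_n.*2.+1) := [set q | tnth v q == n.*2 :> nat].
transitivity (\sum_(R : {set 'I_n}) \sum_(v : n.-tuple 'I_n.*2.+1)
    signed_eval phi (tfun v) * (v == x R)%:R).
  apply: eq_bigr => R _; rewrite (bigD1 (x R)) //= eqxx mulr1 xE.
  by rewrite [X in _ + X]big1 ?addr0 // => v /negbTE ->; rewrite mulr0.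
rewrite exchange_big; apply: eq_bigr => v _ /=; rewrite -mulr_sumr; congr (_ * _).
have xU R : U (x R) = R.
  apply/setP => q; rewrite inE tnth_mktuple /= /X /split_word.
  case: (boolP (q \in R)) => qR; first by rewrite eqxx.
  by have := ltn_ord (tnth w q); rewrite /tfun /=; lia.
rewrite (bigD1 (U v)) //= [X in _ + X]big1 ?addr0; last first.
  by move=> R RU; case: eqP => // e; rewrite e xU eqxx in RU.
have W q : (tnth w q).*2.+1 != n.*2 by lia.
case: eqP => [e|ne].
  rewrite big1 // => q _; rewrite e tnth_mktuple /= /X /split_word.
  case: ifP => _; first by rewrite eqxx eq_sym (negbTE (W q)) add0r.
  by rewrite /tfun eqxx (negbTE (W q)) addr0.
have [q Hq] : exists q, tnth v q != tnth (x (U v)) q.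
  apply/existsP; rewrite -negb_forall; apply/negP => /forallP H; apply: ne.
  by apply: eq_from_tnth => q; apply/eqP.
rewrite (bigD1 q) //= (_ : _ + _ = 0) ?mul0r //.
move: Hq; rewrite tnth_mktuple -val_eqE /= /X /split_word inE.
by case: (eqVneq (tnth v q : nat) n.*2) => [->|vn]; rewrite ?eqxx // => /negbTE ->; rewrite addr0.
Qed.

Lemma Phi_virtual n (phi : packing n -> K) (v : packing n) :
  Phi (evalA (WQ_of phi)) = 0 -> \sum_u phi u * virtual_coef K u v = 0.
Proof.
move=> P0; rewrite sum_virtual_coef.
pose w : n.-tuple 'I_n := [tuple val v q | q < n].
have wE : tfun w = v by apply: boolp.funext => q; rewrite /tfun tnth_mktuple.
rewrite -wE sum_signed_eval_split.
have := congr1 (fun h : ncseq K bd_alph => nccoef (ncsubst (@theta n) (h n)) w) P0.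
rewrite /Phi ncsubst_comp; try exact: linear_a_value; try exact: linear_theta.
rewrite ncsubst0 nccoef0 => E; rewrite -[RHS]E.
rewrite (nccoef_subst_linear _ w); last by move=> t; apply: subst_a_linear; apply: linear_theta.
apply: eq_bigr => t _; rewrite nccoef_evalA_of; congr (_ * _).
by apply: eq_bigr => q _; rewrite nccoef_theta_a.
Qed.

End PhiSolutions.

(** * Counting packed words *)

Section Counting.
Variable n : nat.

Definition blocks (u : packing n) : seq {set 'I_n} :=
  [seq [set p | u p == i] | i <- iota 0 (nletters u)].

Lemma size_blocks u : size (blocks u) = nletters u.
Proof. by rewrite size_map size_iota. Qed.

Lemma blocks_subproof u : (size (blocks u) <= n)%N.
Proof. by rewrite size_blocks nletters_le. Qed.

Definition bblocks u : n.-bseq {set 'I_n} := Bseq (blocks_subproof u).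

Lemma nth_blocks (u : packing n) i : (i < nletters u)%N ->
  nth set0 (blocks u) i = [set p | u p == i].
Proof. by move=> ir; rewrite (nth_map 0%N) ?size_iota // nth_iota. Qed.

Lemma bblocks_inj : injective bblocks.
Proof.
move=> u v /(congr1 val) /= e; apply: packing_inj => p.
have r : nletters u = nletters v by rewrite -!size_blocks e.
have pu : p \in nth set0 (blocks u) (u p) by rewrite nth_blocks ?inE // ltn_nletters.
by move: pu; rewrite e nth_blocks -?r ?ltn_nletters // inE => /eqP.
Qed.

Lemma blocks_composition u : set_composition (blocks u).
Proof.
have nz (A : {set 'I_n}) : A \in blocks u -> A != set0.
  move=> /(nthP set0)[i]; rewrite size_blocks => ir <-; rewrite nth_blocks //.
  by have [p up] := nlettersP ir; apply/set0Pn; exists p; rewrite inE up.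
apply/and3P; split; first by apply/negP => /nz; rewrite eqxx.
- apply/(pairwiseP set0) => i j; rewrite !inE size_blocks => ir jr ij.
  rewrite !nth_blocks //; apply/pred0P => p /=; rewrite !inE.
  by case: eqP => //= ->; apply/negbTE; rewrite neq_ltn ij.
- apply/forallP => p; apply/hasP; have up := ltn_nletters u p.
  exists (nth set0 (blocks u) (u p)); first by rewrite mem_nth // size_blocks.
  by rewrite nth_blocks // inE.
Qed.

Lemma set_compositionP c : set_composition c -> exists u, blocks u = c.
Proof.
case/and3P => c0 cP /forallP cov.
pose f p := find (fun A : {set 'I_n} => p \in A) c.
have fc p : (f p < size c)%N by rewrite -has_find.
have fE p i : (i < size c)%N -> (f p == i) = (p \in nth set0 c i).
  move=> ic; apply/eqP/idP => [<-|pi].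
    by rewrite -[_ \in _]/((fun A : {set 'I_n} => p \in A) _) nth_find.
  have pf : p \in nth set0 c (f p).
    by rewrite -[_ \in _]/((fun A : {set 'I_n} => p \in A) _) nth_find.
  have D j k : (j < k)%N -> (k < size c)%N -> p \in nth set0 c j -> p \in nth set0 c k -> False.
    move=> jk kc pj pk; have /(pairwiseP set0)/(_ j k) := cP.
    rewrite !inE kc (ltn_trans jk kc) => /(_ isT isT jk)/pred0P/(_ p) /=.
    by rewrite pj pk.
  by case: (ltngtP (f p) i) => // lt; [case: (D _ _ lt ic pf pi) | case: (D _ _ lt (fc p) pi pf)].
have nz i : (i < size c)%N -> exists p, f p = i.
  move=> ic; have /set0Pn[p pi] : nth set0 c i != set0.
    by apply: contraNneq c0 => <-; apply: mem_nth.
  by exists p; apply/eqP; rewrite fE.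
have fu : packf f =1 f.
  apply: gapless_inj; [exact: packing_gapless | | exact: same_order_packf].
  by move=> p j jp; apply: nz; apply: ltn_trans jp (fc p).
have rE : nletters (packf f) = size c.
  apply/eqP; rewrite eqn_leq; apply/andP; split.
    by apply/bigmax_leqP => p _; rewrite fu fc.
  case: (posnP (size c)) => [->//|c_gt0].
  have [|p fp] := nz (size c).-1; first by rewrite prednK.
  by have := ltn_nletters (packf f) p; rewrite fu fp prednK.
exists (packf f); apply: (@eq_from_nth _ set0); rewrite size_blocks rE // => i ic.
rewrite nth_blocks ?rE //; apply/setP => p; rewrite inE fu; exact: fE.
Qed.

Lemma card_packing_parity (b : bool) :
  #|[pred u : packing n | odd (nletters u) == b]| = num_set_compositions n b.
Proof.
rewrite /num_set_compositions -(card_imset _ bblocks_inj); apply: eq_card => c.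
rewrite inE; apply/imsetP/andP => [[u ub ->]|[cc cb]].
  by split; [exact: blocks_composition | rewrite /= size_blocks].
have [u uc] := set_compositionP cc; exists u; last by apply: val_inj; rewrite /= uc.
by rewrite inE -size_blocks uc.
Qed.

End Counting.

(** * Linear algebra *)

Section Idempotents.
Variable K : numFieldType.

(** In a full rank factorization P = CR, the equation CRCR = CR cancels to RC = 1, and CR and RC
    have the same trace. *)
Lemma mxtrace_idempotent d (P : 'M[K]_d) : P *m P = P -> \tr P = (\rank P)%:R.
Proof.
move=> PP; have : row_base P *m col_base P = 1%:M.
  have E : col_base P *m (row_base P *m col_base P) *m row_base P =
           col_base P *m 1%:M *m row_base P.
    by rewrite mulmx1 mulmxA mulmx_base -mulmxA mulmx_base PP.
  exact: (row_full_inj (col_base_full P) (row_free_inj (row_base_free P) E)).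
by move=> E; rewrite -{1}(mulmx_base P) mxtrace_mulC E mxtrace1.
Qed.

(** The [e] columns of [G] bound its rank by [e], while the inclusion of kernels bounds it below by
    the rank of [P], which is its trace [e]. So the kernels have the same dimension. *)
Lemma rank_of_trace d e (G : 'M[K]_(d, e)) (P : 'M[K]_d) :
  P *m P = P -> \tr P = e%:R -> (kermx G <= kermx P)%MS ->
  \rank G = e /\ (kermx P <= kermx G)%MS.
Proof.
move=> PP; rewrite mxtrace_idempotent // => /eqP; rewrite eqr_nat => /eqP rP GP.
have := mxrankS GP; rewrite !mxrank_ker rP => H.
have := rank_leq_col G; have := rank_leq_row G; have := rank_leq_row P; rewrite rP => H1 H2 H3.
have rG : \rank G = e by lia.
split=> //; have := mxrank_leqif_sup GP; rewrite !mxrank_ker rP rG => -[_].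
by rewrite eqxx.
Qed.

Variable V : lmodType K.

Lemma has_dim_image d r (M : 'M[K]_(r, d)) (f : 'rV[K]_d -> V) (W : classical_sets.set V) :
  row_free M -> (forall c x y, f (c *: x + y) = c *: f x + f y) ->
  (forall x, f x = 0 -> x = 0) ->
  (forall v, W v <-> exists2 x, (x <= M)%MS & v = f x) -> has_dim W r.
Proof.
move=> Mfree flin finj WE.
have f0 : f 0 = 0.
  by apply: (addrI (f 0)); rewrite addr0 -{1}[f 0]scale1r -flin scale1r addr0.
have fsum (T : Type) (s : seq T) (c : T -> K) (x : T -> 'rV[K]_d) :
    f (\sum_(t <- s) c t *: x t) = \sum_(t <- s) c t *: f (x t).
  by elim: s => [|t s IH]; rewrite ?big_nil ?big_cons // flin IH.
exists (fun i => f (row i M)); split.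
  move=> c; rewrite -fsum => /finj.
  have -> : \sum_i c i *: row i M = (\row_i c i) *m M.
    by rewrite mulmx_sum_row; apply: eq_bigr => i _; rewrite mxE.
  move=> cM i; have : \row_i c i = 0 by apply: (row_free_inj Mfree); rewrite mul0mx.
  by move/rowP/(_ i); rewrite !mxE.
apply: classical_sets.eq_set => v; apply/boolp.propext; rewrite WE; split.
  case=> x /submxP[D ->] ->; exists r, (D 0), (fun i => f (row i M)); split.
    by move=> i; exists i.
  by rewrite mulmx_sum_row fsum.
case=> k [c [x [xE ->]]].
have H j : exists i : 'I_r, f (row i M) = x j by have [i _ <-] := xE j; exists i.
have [i iE] := fin_all_exists H.
exists (\sum_j c j *: row (i j) M).
  by apply: summx_sub => j _; apply: scalemx_sub; apply: row_sub.
by rewrite fsum; apply: eq_bigr => j _; rewrite iE.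
Qed.

End Idempotents.

(** * The kernel and the image *)

Section Kernel.
Variable K : numFieldType.

(* K_n in coordinates: the span of the functions of the word that ignore the
   letter at some position. *)
Inductive Kspan n : (packing n -> K) -> Prop :=
| Kspan0 : Kspan (fun=> 0)
| Kspan_add (c : K) p (phi psi : packing n -> K) : indep p phi -> Kspan psi ->
    Kspan (fun u => c * phi u + psi u).

Lemma Kspan_ext n (phi psi : packing n -> K) : phi =1 psi -> Kspan phi -> Kspan psi.
Proof. by move=> /boolp.funext ->. Qed.

Lemma KspanP n c (phi psi : packing n -> K) : Kspan phi -> Kspan psi ->
  Kspan (fun u => c * phi u + psi u).
Proof.
elim=> [|a p f g If _ IH] Kpsi.
  by apply: Kspan_ext Kpsi => u; rewrite mulr0 add0r.
apply: Kspan_ext (Kspan_add (c * a) If (IH Kpsi)) => u.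
by rewrite mulrDr mulrA addrA.
Qed.

Lemma Kspan_indep n p (phi : packing n -> K) : indep p phi -> Kspan phi.
Proof.
move=> ip; apply: Kspan_ext (Kspan_add 1 ip (@Kspan0 n)) => u.
by rewrite mul1r addr0.
Qed.

Lemma Kspan_sum n (T : Type) (r : seq T) (P : pred T) (F : T -> packing n -> K) :
  (forall t, P t -> Kspan (F t)) -> Kspan (fun u => \sum_(t <- r | P t) F t u).
Proof.
move=> H; elim: r => [|t r IH].
  by apply: Kspan_ext (@Kspan0 n) => u; rewrite big_nil.
have [Pt|nPt] := boolP (P t).
  apply: Kspan_ext (KspanP 1 (H t Pt) IH) => u.
  by rewrite big_cons Pt mul1r.
by apply: Kspan_ext IH => u; rewrite big_cons (negbTE nPt).
Qed.

Lemma Kspan_virtual n (phi : packing n -> K) v : Kspan phi ->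
  \sum_u phi u * virtual_coef K u v = 0.
Proof.
elim=> [|c p f g If _ IH]; first by rewrite big1 // => u _; rewrite mul0r.
under eq_bigr => u _ do rewrite mulrDl -mulrA.
by rewrite big_split /= -mulr_sumr (virtual_indep v If) mulr0 add0r IH.
Qed.

Lemma Kspan_decomp n (phi : packing n -> K) :
  Kspan (fun v => phi v - \sum_u phi u * virtual_coef K u v).
Proof.
have KS := @Kspan_sum n _ (index_enum {set 'I_n}) (fun R : {set 'I_n} => R != set0)
  (fun R v => signed_eval phi (split_word v R n)).
apply: (Kspan_ext _ (KspanP (-1) (KS _) (@Kspan0 n))) => [v|R /set0Pn[p pR]].
  by rewrite virtual_coef_decomp addr0 mulN1r.
apply: (@Kspan_indep n p); exact: indep_split.
Qed.

(** [K_n] is killed by rho; conversely, if rho kills [phi], then [phi] is its own difference with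
    rho([phi]), which lies in [K_n]. *)
Lemma KspanE n (phi : packing n -> K) :
  Kspan phi <-> forall v, \sum_u phi u * virtual_coef K u v = 0.
Proof.
split=> [Kphi v|H]; first exact: Kspan_virtual.
by apply: Kspan_ext (Kspan_decomp phi) => v; rewrite H subr0.
Qed.

(** * The matrices of Phi and of rho *)

Section FullMatrix.
Variable n : nat.

Definition even_packing := {u : packing n | ~~ odd (nletters u)}.

(** The matrix sending [F] to the full coefficients of Phi(F(A)), see [full_coef_Phi]. Its columns
    are indexed by packed words with an even number of letters, which is the upper bound on the
    rank. *)
Definition full_mx_coef (u : packing n) (v : even_packing) : K :=
  \sum_(y : n.-tuple (bd_alph (nletters (val v))./2) |
          [forall q, bd_code (tnth y q) == val v q])
  \sum_(t : n.-tuple 'I_(nletters (val v))./2.*2.+1)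
     refcoef K u (tfun t) * \prod_q a_coef K (tnth t q) (tnth y q).

Lemma full_coef_Phi (phi : packing n -> K) v :
  full_coef (val v) (Phi (evalA (WQ_of phi))) = \sum_u phi u * full_mx_coef u v.
Proof.
under eq_bigr => u _ do rewrite mulr_sumr.
rewrite exchange_big /=; apply: eq_bigr => y _.
rewrite (nccoef_subst_linear _ y (@linear_a_value K _ _)).
under [RHS]eq_bigr => u _ do rewrite mulr_sumr.
rewrite [RHS]exchange_big /=; apply: eq_bigr => t _.
rewrite nccoef_evalA_of mulr_suml; apply: eq_bigr => u _.
rewrite mulrA; congr (_ * _).
by apply: eq_bigr => q _; rewrite nccoef_a_value.
Qed.

Definition vec (T : finType) (f : T -> K) : 'rV[K]_#|T| := \row_i f (enum_val i).
Definition unvec (T : finType) (x : 'rV[K]_#|T|) (t : T) : K := x 0 (enum_rank t).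
Definition fmx (S T : finType) (f : S -> T -> K) : 'M[K]_(#|S|, #|T|) :=
  \matrix_(i, j) f (enum_val i) (enum_val j).

Lemma vecK (T : finType) (f : T -> K) : unvec (vec f) =1 f.
Proof. by move=> t; rewrite /unvec mxE enum_rankK. Qed.

Lemma unvecK (T : finType) (x : 'rV[K]_#|T|) : vec (unvec x) = x.
Proof. by apply/rowP => i; rewrite mxE /unvec enum_valK. Qed.

Lemma sum_enum_val (T : finType) (F : T -> K) :
  \sum_(i < #|T|) F (enum_val i) = \sum_t F t.
Proof.
rewrite [RHS](reindex (@enum_val T T)) //.
by exists enum_rank => s _; rewrite ?enum_rankK ?enum_valK.
Qed.

Lemma mul_vec_fmx (S T : finType) (x : 'rV[K]_#|S|) (f : S -> T -> K) :
  x *m fmx f = vec (fun t => \sum_s unvec x s * f s t).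
Proof.
apply/rowP => j; rewrite !mxE -[RHS]sum_enum_val.
by apply: eq_bigr => i _; rewrite mxE /unvec enum_valK.
Qed.

Lemma vec_eq0 (T : finType) (f : T -> K) : vec f = 0 <-> forall t, f t = 0.
Proof.
split=> [/rowP H t|H]; last by apply/rowP => i; rewrite !mxE H.
by have := H (enum_rank t); rewrite !mxE enum_rankK.
Qed.

Definition fullM := fmx full_mx_coef.
Definition virtM := fmx (fun u v : packing n => virtual_coef K u v).

(** Phi(F(A)) is a solution, so it vanishes as soon as its full coefficients do. *)
Lemma fullM_eq0 (x : 'rV[K]_#|{: packing n}|) :
  x *m fullM = 0 <-> Phi (evalA (WQ_of (unvec x))) = 0.
Proof.
rewrite mul_vec_fmx vec_eq0; split=> H.
  apply: (@SolNC'_full_coef K n); [exact: Phi_of_sol | exact: homog_Phi_of |].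
  by move=> u ou; rewrite (full_coef_Phi _ (exist _ u ou)) H.
move=> v; rewrite -full_coef_Phi H /full_coef /word_coef big1 // => y _.
exact: nccoef_seq0.
Qed.

Lemma virtM_eq0 (x : 'rV[K]_#|{: packing n}|) :
  x *m virtM = 0 <-> Kspan (unvec x).
Proof. by rewrite mul_vec_fmx vec_eq0 KspanE. Qed.

(** By [Kspan_decomp], the difference of the identity and [virtM] takes values in [K_n], which
    [virtM] kills. *)
Lemma virtM_idempotent : virtM *m virtM = virtM.
Proof.
apply/row_matrixP => i; rewrite row_mul; set x := row i virtM.
suff : (delta_mx 0 i - x) *m virtM = 0.
  by rewrite mulmxBl -rowE => /eqP; rewrite subr_eq0 => /eqP <-.
apply/virtM_eq0; rewrite /x rowE.
set d : 'rV[K]_#|{: packing n}| := delta_mx 0 i.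
apply: Kspan_ext (Kspan_decomp (unvec d)) => v.
by rewrite mul_vec_fmx /unvec !mxE enum_rankK.
Qed.

Lemma trace_virtM : \tr virtM = #|{: even_packing}|%:R.
Proof.
rewrite /mxtrace; under eq_bigr => i _ do rewrite mxE virtual_coef_diag.
rewrite (sum_enum_val (fun u : packing n => (~~ odd (nletters u))%:R : K)).
by rewrite -natr_sum card_sig -sum1_card [in RHS]big_mkcond.
Qed.

Lemma fullM_rank : \rank fullM = #|{: even_packing}|
  /\ forall x : 'rV_#|{: packing n}|, x *m fullM = 0 <-> x *m virtM = 0.
Proof.
have sub (x : 'rV_#|{: packing n}|) : x *m fullM = 0 -> x *m virtM = 0.
  move=> /fullM_eq0 P0; rewrite mul_vec_fmx; apply/vec_eq0 => v.
  exact: Phi_virtual P0.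
have [|rk kk] := rank_of_trace virtM_idempotent trace_virtM (G := fullM).
  apply/row_subP => i; apply/sub_kermxP; apply: sub.
  by apply/sub_kermxP; apply: row_sub.
split=> // x; split; first exact: sub.
by move=> /sub_kermxP xv; apply/sub_kermxP; apply: submx_trans xv kk.
Qed.

Lemma Phi_eq0 (phi : packing n -> K) :
  Phi (evalA (WQ_of phi)) = 0 <-> Kspan phi.
Proof.
have e : unvec (vec phi) = phi by apply: boolp.funext; apply: vecK.
have [_ H] := fullM_rank; have := H (vec phi).
by rewrite fullM_eq0 virtM_eq0 e.
Qed.

Lemma card_even_packing : #|{: even_packing}| = num_set_compositions n false.
Proof.
rewrite -card_packing_parity card_sig; apply: eq_card => u.
by rewrite !inE; case: (odd _).
Qed.

Lemma card_packing :
  #|{: packing n}| = (num_set_compositions n false + num_set_compositions n true)%N.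
Proof.
rewrite -!card_packing_parity -(cardID [pred u : packing n | odd (nletters u) == false] {: packing n}).
by congr (_ + _)%N; apply: eq_card => u; rewrite !inE ?andbT //; case: (odd _).
Qed.

End FullMatrix.

End Kernel.

Local Open Scope classical_set_scope.
Local Open Scope ring_scope.

(** * Decomposition by degree *)

Section Grading.
Variable K : numFieldType.

Lemma nccoef_seqP (I : nat -> choiceType) c (F G : ncseq K I) N w :
  nccoef ((c *: F + G) N) w = c * nccoef (F N) w + nccoef (G N) w.
Proof. by rewrite nccoef_seqD nccoef_seqZ. Qed.

Lemma tfun_in_tuple_size n N (w : n.-tuple 'I_N) (phi : forall k, packing k -> K) :
  phi (size w) (packf (tfun (in_tuple w))) = phi n (packf (tfun w)).
Proof.
case: w => s sn /=; have e : size s = n by apply/eqP.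
subst n.
by rewrite (_ : Tuple sn = in_tuple s) //; apply: val_inj.
Qed.

Definition graded_sum D (phi : forall k, packing k -> K) : ncseq K a_alph :=
  \sum_(k < D) WQ_of (phi k).

Lemma nccoef_graded_sum D phi N (w : seq 'I_N) :
  nccoef (graded_sum D phi N) w =
  if (size w < D)%N then phi (size w) (packf (tfun (in_tuple w))) else 0.
Proof.
rewrite /graded_sum nccoef_seq_sum.
have hk k : k != size w -> nccoef (WQ_of (phi k) N) w = 0.
  by rewrite eq_sym; move: N w; apply/homogP; apply: homog_WQ_of.
case: ltnP => wD.
  rewrite (bigD1 (Ordinal wD)) //= [X in _ + X]big1 ?addr0.
    by rewrite -(nccoef_WQ_of _ (in_tuple w)).
  by move=> i iw; apply: hk; apply: contraNneq iw => e; apply/eqP/val_inj.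
rewrite big1 // => i _; apply: hk; have := ltn_ord i; lia.
Qed.

Lemma WQ_P_graded u D : packed u -> (size u < D)%N ->
  WQ_P K u = graded_sum D (fun k v => (pword v == u)%:R).
Proof.
move=> pu uD; apply: ncseqP => N w; rewrite nccoef_graded_sum nccoef_WQ_P.
rewrite -[map val w]/(map val (in_tuple w)) -word_tfun pack_word.
case: ltnP => // Dw; case: eqP => // e.
by move: Dw; rewrite leqNgt -(size_pword (packf (tfun (in_tuple w)))) e uD.
Qed.

Lemma graded_sumP D c (phi psi : forall k, packing k -> K) :
  c *: graded_sum D phi + graded_sum D psi =
  graded_sum D (fun k u => c * phi k u + psi k u).
Proof.
apply: ncseqP => N w; apply: etrans (nccoef_seqP _ _ _ _) _.
apply: etrans (congr2 (fun a b => c * a + b) (nccoef_graded_sum D phi w)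
  (nccoef_graded_sum D psi w)) (etrans _ (esym (nccoef_graded_sum D _ w))).
by case: ifP => _; rewrite ?mulr0 ?addr0.
Qed.

(** Leaving [D] free above [D0] allows it to be raised during the induction, and later beyond a
    prescribed degree. *)
Lemma WQSym_graded F : WQSym K F ->
  exists D0 phi, forall D, (D0 <= D)%N -> F = graded_sum D phi.
Proof.
case=> n [c [x [xP ->]]]; elim: n c x xP => [|n IH] c x xP.
  exists 0%N, (fun k u => 0) => D _; rewrite big_ord0; apply: ncseqP => N w.
  by rewrite nccoef_seq0 nccoef_graded_sum; case: ifP.
have [|D1 [phi H1]] := IH (fun i => c (lift ord0 i)) (fun i => x (lift ord0 i)).
  by move=> i; apply: xP.
have [u pu ux] := xP ord0.
exists (maxn D1 (size u).+1),
  (fun k v => c ord0 * (pword v == u)%:R + phi k v) => D.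
rewrite geq_max => /andP[/H1 E1 uD]; rewrite big_ord_recl E1 -ux.
by rewrite -graded_sumP -(WQ_P_graded pu uD).
Qed.

Lemma WQSym_graded_sum D phi : WQSym K (graded_sum D phi).
Proof.
rewrite /graded_sum; elim/big_rec: _ => [|k x _ Wx]; first exact: lin_span0.
rewrite -[WQ_of _]scale1r; apply: lin_spanP => //; exact: WQSym_of.
Qed.

Lemma WQSym_lin c F G : WQSym K F -> WQSym K G -> WQSym K (c *: F + G).
Proof. exact: lin_spanP. Qed.

Lemma WQ_of_lin n c (phi psi : packing n -> K) :
  c *: WQ_of phi + WQ_of psi = WQ_of (fun u => c * phi u + psi u).
Proof.
rewrite /WQ_of scaler_sumr -big_split /=; apply: eq_bigr => u _.
by rewrite scalerDl scalerA.
Qed.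

Lemma WQ_of_ext n (phi : packing n -> K) F :
  homog n F -> (forall N (w : n.-tuple 'I_N), nccoef (F N) w = phi (packf (tfun w))) ->
  F = WQ_of phi.
Proof.
move=> /homogP hF H; apply: ncseqP => N w; have [wn|wn] := eqVneq (size w) n.
  by case: n / wn phi hF H => phi hF H; rewrite (H _ (in_tuple w)) (nccoef_WQ_of _ (in_tuple w)).
rewrite hF //; apply/esym; move: N w wn; apply/homogP; exact: homog_WQ_of.
Qed.

Lemma WQ_of_inj n (phi psi : packing n -> K) : WQ_of phi = WQ_of psi -> phi =1 psi.
Proof.
move=> e u; pose w : n.-tuple 'I_n := [tuple val u q | q < n].
have wu : packf (tfun w) = u.
  by apply: eq_packf => q r; rewrite /tfun !tnth_mktuple.
have E1 := nccoef_WQ_of phi w; have E2 := nccoef_WQ_of psi w.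
by rewrite -wu -E1 -E2 e.
Qed.

Lemma graded_sum_homog D phi n : (n < D)%N -> homog n (graded_sum D phi) ->
  graded_sum D phi = WQ_of (phi n).
Proof.
move=> nD hn; apply: WQ_of_ext => // N w.
by rewrite nccoef_graded_sum tfun_in_tuple_size size_tuple nD.
Qed.

Lemma WQSym_homog n F : WQSym K F -> homog n F -> exists phi : packing n -> K, F = WQ_of phi.
Proof.
move=> /WQSym_graded[D0 [phi FE]] hF; have nD := leq_maxr D0 n.+1.
rewrite (FE _ (leq_maxl D0 n.+1)) in hF *; exists (phi n).
exact: graded_sum_homog.
Qed.

Lemma Phi_lin c (F G : ncseq K a_alph) : Phi (c *: F + G) = c *: Phi F + Phi G.
Proof.
apply: ncseqP => m w; rewrite [RHS]nccoef_seqP /Phi.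
have lin := @linear_a_value K m m.*2.+1.
apply: etrans (nccoef_subst_linear _ (in_tuple w) lin) _.
apply: etrans _ (congr2 (fun a b => c * a + b)
  (esym (nccoef_subst_linear (F _) (in_tuple w) lin))
  (esym (nccoef_subst_linear (G _) (in_tuple w) lin))).
rewrite mulr_sumr -big_split /=.
by apply: eq_bigr => v _; rewrite nccoef_seqP mulrDl mulrA.
Qed.

Lemma PhiA_graded D phi : Phi (evalA (graded_sum D phi)) =
  \sum_(k < D) Phi (evalA (WQ_of (phi k))).
Proof.
have E (T : lmodType K) (f : 'I_D -> T) : \sum_(k < D) f k = \sum_(k < D) 1 *: f k.
  by apply: eq_bigr => k _; rewrite scale1r.
rewrite /graded_sum E [RHS]E.
apply: (@lin_on_sum _ _ _ (WQSym K) (fun F => Phi (evalA F))).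
- exact: lin_span0.
- by move=> a x y; apply: lin_spanP.
- by move=> a x y Wx Wy; rewrite evalA_lin // Phi_lin.
- by move=> k; apply: WQSym_of.
Qed.

Lemma nccoef_sum_homog (I : nat -> choiceType) D (H : nat -> ncseq K I) N w :
  (forall k, homog k (H k)) ->
  nccoef ((\sum_(k < D) H k) N) w =
  if (size w < D)%N then nccoef (H (size w) N) w else 0.
Proof.
move=> hH; rewrite nccoef_seq_sum.
have hk k : k != size w -> nccoef (H k N) w = 0.
  by rewrite eq_sym; move: N w; apply/homogP; apply: hH.
case: ltnP => wD.
  rewrite (bigD1 (Ordinal wD)) //= [X in _ + X]big1 ?addr0 //.
  by move=> i iw; apply: hk; apply: contraNneq iw => e; apply/eqP/val_inj.
rewrite big1 // => i _; apply: hk; have := ltn_ord i; lia.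
Qed.

Lemma sum_homog_comp (I : nat -> choiceType) D (H : nat -> ncseq K I) n :
  (forall k, homog k (H k)) -> (n < D)%N -> homog n (\sum_(k < D) H k) ->
  \sum_(k < D) H k = H n.
Proof.
move=> hH nD /homogP hn; apply: ncseqP => N w.
have [wn|wn] := eqVneq (size w) n; last first.
  by rewrite hn //; apply/esym; move: N w wn; apply/homogP.
by rewrite nccoef_sum_homog // wn nD.
Qed.

Lemma sum_homog_eq0 (I : nat -> choiceType) D (H : nat -> ncseq K I) :
  (forall k, homog k (H k)) -> \sum_(k < D) H k = 0 ->
  forall k, (k < D)%N -> H k = 0.
Proof.
move=> hH H0 k kD; apply: ncseqP => N w; rewrite nccoef_seq0.
have [wk|wk] := eqVneq (size w) k; last by move: N w wk; apply/homogP.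
have := congr1 (fun F : ncseq K I => nccoef (F N) w) H0.
by rewrite /= nccoef_sum_homog // wk kD nccoef_seq0.
Qed.

(** F -> Phi(F(A)) preserves degrees, so the kernel contains the homogeneous components of its
    elements, and [Phi_eq0] applies to each degree. *)
Lemma KcalP F : Kcal K F <->
  exists D phi, (forall k, Kspan (phi k)) /\ F = graded_sum D phi.
Proof.
split=> [[/WQSym_graded[D [phi FE]] P0]|[D [phi [Kphi ->]]]].
  rewrite (FE D (leqnn D)) PhiA_graded in P0.
  have := sum_homog_eq0 (H := fun k => Phi (evalA (WQ_of (phi k))))
    (fun k => @homog_Phi_of K k (phi k)) P0 => {}P0.
  (* Nothing is known about [phi k] for [k >= D], so it is replaced by zero. *)
  exists D, (fun k u => if (k < D)%N then phi k u else 0); split=> [k|].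
    by case: ltnP => kD; [apply/Phi_eq0/P0 | apply: Kspan0].
  rewrite (FE D (leqnn D)); apply: ncseqP => N w.
  apply: etrans (nccoef_graded_sum D _ w) (etrans _ (esym (nccoef_graded_sum D _ w))).
  by case: ifP.
split; first exact: WQSym_graded_sum.
by rewrite PhiA_graded big1 // => k _; apply/Phi_eq0.
Qed.

End Grading.

(** * The kernel as the smallest symmetric ideal containing P_1 *)

Section Ideal.
Variable K : numFieldType.

Lemma nccoef_pos_act n (G : ncseq K a_alph) (s : 'S_n) N (v : n.-tuple 'I_N) :
  nccoef (pos_act G s N) v = nccoef (G N) [tuple tnth v (s^-1%g i) | i < n].
Proof.
rewrite /pos_act nccoef_sum.
under eq_bigr => w _ do rewrite nccoefZ nccoef_word.
pose w0 := [tuple tnth v (s^-1%g i) | i < n].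
have w0E : [tuple tnth w0 (s i) | i < n] = v.
  by apply: eq_from_tnth => i; rewrite !tnth_mktuple permK.
rewrite (bigD1 w0) // w0E eqxx mulr1 /= [X in _ + X]big1 ?addr0 //.
move=> w ww0; rewrite (_ : _ == _ = false) ?mulr0 //.
apply: contraNF ww0 => /eqP e; apply/eqP/eq_from_tnth => i.
have {}e : [tuple tnth w (s i) | i < n] = v by apply: val_inj.
by rewrite /w0 tnth_mktuple -e tnth_mktuple permKV.
Qed.

Lemma homog_pos_act n (G : ncseq K a_alph) (s : 'S_n) : homog n (pos_act G s).
Proof.
apply/homogP => N w wn; rewrite /pos_act nccoef_sum big1 // => v _.
rewrite nccoefZ nccoef_word; case: eqP => [e|_]; last by rewrite mulr0.
by rewrite -e size_tuple eqxx in wn.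
Qed.

Lemma packf_comp n k (f : 'I_n -> nat) (g : 'I_k -> 'I_n) :
  packf (fun q => packf f (g q)) = packf (fun q => f (g q)).
Proof. by apply: packf_same_order => p q; apply: same_order_packf. Qed.

Lemma pos_act_WQ_of n (phi : packing n -> K) (s : 'S_n) :
  pos_act (WQ_of phi) s = WQ_of (fun u => phi (packf (fun q => u (s^-1%g q)))).
Proof.
apply: WQ_of_ext; first exact: homog_pos_act.
move=> N w; rewrite nccoef_pos_act nccoef_WQ_of packf_comp; congr (phi (packf _)).
by apply: funext => q; rewrite /tfun tnth_mktuple.
Qed.

Lemma homogM j k (F G : ncseq K a_alph) : homog j F -> homog k G -> homog (j + k) (F * G).
Proof.
move=> /homogP hF /homogP hG; apply/homogP => N w wjk.
rewrite nccoef_seqM big1 // => i _; have := ltn_ord i; rewrite ltnS => ile.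
have [ij|ij] := eqVneq (i : nat) j; last by rewrite hF ?mul0r // size_takel.
rewrite hG ?mulr0 // size_drop; apply: contraNneq wjk => <-.
by rewrite -ij subnKC.
Qed.

(** [d] and the two embeddings are parameters so that a product with [P_1] is indexed by
    [packing n.+1] instead of [packing (n + 1)]. *)
Lemma mul_WQ_of j k d (l : 'I_j -> 'I_d) (r : 'I_k -> 'I_d)
    (psi : packing j -> K) (phi : packing k -> K) :
  (j + k)%N = d -> (forall p, l p = p :> nat) -> (forall p, r p = (j + p)%N :> nat) ->
  WQ_of psi * WQ_of phi = WQ_of (fun u : packing d =>
    psi (packf (fun q => u (l q))) * phi (packf (fun q => u (r q)))).
Proof.
move=> e; subst d => lE rE.
have lS p : l p = lshift k p by apply: val_inj; rewrite /= lE.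
have rS p : r p = rshift j p by apply: val_inj; rewrite /= rE.
apply: WQ_of_ext; first by apply: homogM; apply: homog_WQ_of.
move=> N w; rewrite !packf_comp.
pose wl := [tuple tnth w (l p) | p < j]; pose wr := [tuple tnth w (r p) | p < k].
have wE : tval w = tval wl ++ tval wr.
  rewrite -[RHS]/(tval (cat_tuple wl wr)); congr tval; apply: eq_from_tnth => i.
  case: (split_ordP i) => p ->.
    by rewrite tnth_lshift tnth_mktuple lS.
  by rewrite tnth_rshift tnth_mktuple rS.
have jlt : (j < (size w).+1)%N by rewrite size_tuple ltnS leq_addr.
have /homogP hpsi : homog j (WQ_of psi) := @homog_WQ_of K j psi.
rewrite nccoef_seqM (bigD1 (Ordinal jlt)) //= [X in _ + X]big1 ?addr0; last first.
  move=> i ij; rewrite hpsi ?mul0r // size_takel; last first.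
    by rewrite -ltnS; apply: ltn_ord.
  by apply: contraNneq ij => e; apply/eqP/val_inj.
rewrite wE take_size_cat ?size_tuple // drop_size_cat ?size_tuple //.
rewrite (nccoef_WQ_of psi wl) (nccoef_WQ_of phi wr).
by congr (psi (packf _) * phi (packf _)); apply: funext => q; rewrite /tfun tnth_mktuple.
Qed.

Lemma WQ_P1E : WQ_P K [:: 1%N] = WQ_of (fun _ : packing 1 => 1).
Proof.
have E N (x : 'I_N) : pack (map val [:: x]) = [:: 1%N].
  by rewrite /pack /= eqxx.
apply: WQ_of_ext.
  apply/homogP => N w w1; rewrite nccoef_WQ_P; case: eqP => // e.
  by move: (congr1 size e) w1; rewrite !size_map => ->.
move=> N w; rewrite nccoef_WQ_P.
by case/tupleP: w => x w; rewrite /= (tuple0 w) E eqxx.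
Qed.

Lemma mul_P1 n (psi : packing n -> K) : WQ_of psi * WQ_P K [:: 1%N] =
  WQ_of (fun u : packing n.+1 => psi (packf (fun q => u (lift ord_max q)))).
Proof.
rewrite WQ_P1E (@mul_WQ_of n 1 n.+1 (lift ord_max) (fun=> ord_max)).
- by congr WQ_of; apply: funext => u; rewrite mulr1.
- by rewrite addn1.
- by move=> p; rewrite lift_max.
- by move=> p; rewrite (ord1 p) addn0.
Qed.

Lemma indep_comp n m (g : 'I_m -> 'I_n) p q (phi : packing m -> K) :
  (forall r, (g r == q) -> r = p) -> indep p phi ->
  indep q (fun u : packing n => phi (packf (fun r => u (g r)))).
Proof.
move=> gp ip f f' ff'; rewrite !packf_comp; apply: ip => r rp; apply: ff'.
by apply: contra_neq rp => /eqP /gp.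
Qed.

(** Serves for products on both sides and for the action on positions. The other factor [h] ignores
    the whole image of [g], so a generator ignoring [p] yields one ignoring [g p]. *)
Lemma Kspan_comp n m (g : 'I_m -> 'I_n) (phi : packing m -> K) (h : packing n -> K) :
  injective g -> (forall q, indep (g q) h) -> Kspan phi ->
  Kspan (fun u : packing n => h u * phi (packf (fun r => u (g r)))).
Proof.
move=> ginj hg; elim=> [|c p f f' If _ IH].
  by apply: Kspan_ext (@Kspan0 K n) => u; rewrite mulr0.
have Ip : indep (g p) (fun u : packing n => h u * f (packf (fun r => u (g r)))).
  move=> x y xy; rewrite (hg p _ _ xy); congr (_ * _).
  by move: x y xy; apply: indep_comp If => r /eqP /ginj.
apply: Kspan_ext (Kspan_add c Ip IH) => u.
by rewrite mulrDr mulrCA.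
Qed.

Lemma Kspan_pos_act n (phi : packing n -> K) (s : 'S_n) : Kspan phi ->
  Kspan (fun u => phi (packf (fun q => u (s^-1%g q)))).
Proof.
move=> Kphi; have ci q : indep q (fun _ : packing n => 1 : K) by [].
by apply: Kspan_ext (Kspan_comp (@perm_inj _ s^-1%g) (fun q => ci _) Kphi) => u; rewrite mul1r.
Qed.

(** Two words that agree only in their relative order off [p] become comparable once the letter at
    [p] is replaced by one below all others, which [lift0] does. *)
Lemma indep_order n p (phi : packing n -> K) (f g : 'I_n -> nat) : indep p phi ->
  (forall q r, q != p -> r != p -> (f q <= f r)%N = (g q <= g r)%N) ->
  phi (packf f) = phi (packf g).
Proof.
move=> ip fg; pose lift0 (h : 'I_n -> nat) q := if q == p then 0%N else (h q).+1.
have E h : phi (packf h) = phi (packf (lift0 h)).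
  rewrite (packf_same_order (g := fun q => (h q).+1)) //.
  by apply: ip => q /negbTE qp; rewrite /lift0 qp.
rewrite E [RHS]E; congr phi; apply: packf_same_order => q r; rewrite /lift0.
by case: (eqVneq q p); case: (eqVneq r p) => // rp qp; rewrite !ltnS fg.
Qed.

Lemma indep_Kcal_deg n p (phi : packing n.+1 -> K) : indep p phi ->
  Kcal_deg K n.+1 (WQ_of phi).
Proof.
move=> ip; apply: lin_span_mem.
(* [s] takes position [p] to the last one, where the letter of [P_1] stands, and keeps the order of
   the others. [ext] refills position [p] with an arbitrary letter, which [phi] ignores. *)
pose s := lift_perm p ord_max (1%g : 'S_n).
pose ext (t : 'I_n -> nat) q := if unlift p q is Some j then t j else 0%N.
exists (WQ_of (fun t : packing n => phi (packf (ext t)))), s; split.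
  by split; [apply: WQSym_of | apply: homog_WQ_of].
have sE j : s^-1%g (lift ord_max j) = lift p j.
  by apply: (@perm_inj _ s); rewrite permKV lift_perm_lift perm1.
rewrite mul_P1 pos_act_WQ_of; congr WQ_of; apply: funext => u.
rewrite -[u in LHS]packfK; apply: indep_order ip _ => q r qp rp.
rewrite eq_sym in qp; rewrite eq_sym in rp.
have [j -> _] := unlift_some qp; have [k -> _] := unlift_some rp.
by rewrite /ext !liftK !same_order_packf !sE.
Qed.

Lemma Kspan_Kcal_deg n (phi : packing n.+1 -> K) : Kspan phi ->
  Kcal_deg K n.+1 (WQ_of phi).
Proof.
elim=> [|c p f g If _ IH].
  rewrite (_ : WQ_of _ = 0); first exact: lin_span0.
  by rewrite /WQ_of big1 // => u _; rewrite scale0r.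
rewrite -WQ_of_lin; apply: lin_spanP IH; exact: indep_Kcal_deg If.
Qed.

Lemma Kcal_deg_Kspan n F : Kcal_deg K n.+1 F ->
  exists2 phi : packing n.+1 -> K, Kspan phi & F = WQ_of phi.
Proof.
case=> k [c [x [xP ->]]]; elim: k c x xP => [|k IH] c x xP.
  exists (fun=> 0); first exact: Kspan0.
  by rewrite big_ord0 /WQ_of big1 // => u _; rewrite scale0r.
have [|psi Kpsi psiE] := IH (fun i => c (lift ord0 i)) (fun i => x (lift ord0 i)).
  by move=> i; apply: xP.
have [G [s [[WG hG] xE]]] := xP ord0.
have [g GE] := WQSym_homog WG hG.
rewrite big_ord_recl psiE xE GE mul_P1 pos_act_WQ_of WQ_of_lin.
eexists; last by reflexivity.
apply: KspanP Kpsi; apply: (@Kspan_indep _ _ (s^-1%g ord_max)) => f f' ff'.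
congr g; rewrite !packf_comp; congr packf; apply: funext => q.
apply: ff'; rewrite (inj_eq perm_inj) eq_sym; exact: neq_lift.
Qed.

Lemma PhiA_lin c (F G : ncseq K a_alph) : WQSym K F -> WQSym K G ->
  Phi (evalA (c *: F + G)) = c *: Phi (evalA F) + Phi (evalA G).
Proof. by move=> WF WG; rewrite evalA_lin // Phi_lin. Qed.

Lemma Kcal_lin c F G : Kcal K F -> Kcal K G -> Kcal K (c *: F + G).
Proof.
move=> [WF PF] [WG PG]; split; first exact: WQSym_lin.
have P (x y : ncseq K bd_alph) : x = 0 -> y = 0 -> c *: x + y = 0.
  by move=> -> ->; rewrite scaler0 addr0.
exact: etrans (PhiA_lin c WF WG) (P _ _ PF PG).
Qed.

Lemma Kcal_of n (phi : packing n -> K) : Kcal K (WQ_of phi) <-> Kspan phi.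
Proof.
split=> [[_ /Phi_eq0 //]|Kphi]; split; first exact: WQSym_of.
exact/Phi_eq0.
Qed.

Lemma Kcal0 : Kcal K 0.
Proof.
split; first exact: lin_span0.
rewrite (_ : 0 = WQ_of (fun _ : packing 0 => 0 : K)); last first.
  by rewrite /WQ_of big1 // => u _; rewrite scale0r.
exact/Phi_eq0/Kspan0.
Qed.

Lemma Kcal_sum (T : Type) (r : seq T) (P : pred T) (F : T -> ncseq K a_alph) :
  (forall t, P t -> Kcal K (F t)) -> Kcal K (\sum_(t <- r | P t) F t).
Proof.
move=> KF; elim/big_rec: _ => [|t x Pt Kx]; first exact: Kcal0.
rewrite -[F t]scale1r; apply: Kcal_lin Kx; exact: KF.
Qed.

(** In degree 0 there is no position to ignore: the kernel contains no nonzero constant, and the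
    direct sum starts in degree 1. *)
Lemma Kspan_deg0 (phi : packing 0 -> K) : Kspan phi -> phi = fun=> 0.
Proof.
elim=> [//|c p f g If _ ->]; by case: p If.
Qed.

Lemma Kcal_deg_Kcal n F : Kcal_deg K n.+1 F -> Kcal K F.
Proof. by case/Kcal_deg_Kspan => phi Kphi ->; apply/Kcal_of. Qed.

Lemma graded_sum_positive D (phi : forall k, packing k -> K) : phi 0%N = (fun=> 0) ->
  graded_sum D phi = \sum_(1 <= k < D) WQ_of (phi k).
Proof.
move=> phi0; rewrite /graded_sum -(big_mkord xpredT (fun k => WQ_of (phi k))).
case: D => [|D]; first by rewrite !big_geq.
rewrite big_ltn // phi0 (_ : WQ_of _ = 0) ?add0r //.
by rewrite /WQ_of big1 // => u _; rewrite scale0r.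
Qed.

Lemma Kcal_direct_sum : direct_sum (Kcal K) (Kcal_deg K).
Proof.
split.
  apply/seteqP; split=> F.
    move=> /KcalP[D [phi [Kphi ->]]]; exists D, (fun k => WQ_of (phi k)); split.
      by case=> // n _; apply: Kspan_Kcal_deg.
    by apply: graded_sum_positive; apply: Kspan_deg0.
  case=> N [u [uK ->]]; rewrite big_nat; apply: Kcal_sum => -[//|n] nN.
  exact: Kcal_deg_Kcal (uK _ nN).
move=> N u uK u0.
(* Nothing is known about [u k] outside the range, whereas zero is homogeneous of every degree. *)
pose H k := if (1 <= k < N)%N then u k else 0.
have hH k : homog k (H k).
  rewrite /H; case: ifP => [kN|_]; last by apply/homogP => M w _; rewrite nccoef_seq0.
  case: k kN => // k kN; have [phi _ ->] := Kcal_deg_Kspan (uK _ kN).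
  exact: homog_WQ_of.
move=> n nN; have [n1 n2] := andP nN.
have HE : \sum_(k < N) H k = 0.
  rewrite -(big_mkord xpredT H) -[RHS]u0; case: (N) @H hH n2 => [//|M] H hH n2.
  rewrite big_ltn // {1}/H /= add0r big_nat [RHS]big_nat.
  by apply: eq_bigr => k kM; rewrite /H kM.
by have := sum_homog_eq0 hH HE n2; rewrite /H nN.
Qed.

Lemma Kcal_ideal : WQ_sym_ideal (Kcal K).
Proof.
split.
- by move=> F [].
- exact: Kcal0.
- by move=> c F G; apply: Kcal_lin.
- move=> F G /WQSym_graded[D [phi /(_ D (leqnn D)) ->]] /KcalP[D' [psi [Kpsi ->]]].
  rewrite mulr_suml; apply: Kcal_sum => i _; rewrite mulr_sumr; apply: Kcal_sum => j _.
  rewrite (@mul_WQ_of i j _ (@lshift i j) (@rshift i j)) //; apply/Kcal_of.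
  apply: (Kspan_comp (@rshift_inj _ _)) => // q f g fg; congr (phi _ _).
  rewrite !packf_comp; congr packf; apply: funext => r; apply: fg.
  by rewrite eq_lrshift.
- move=> F G /KcalP[D' [psi [Kpsi ->]]] /WQSym_graded[D [phi /(_ D (leqnn D)) ->]].
  rewrite mulr_suml; apply: Kcal_sum => i _; rewrite mulr_sumr; apply: Kcal_sum => j _.
  rewrite (@mul_WQ_of i j _ (@lshift i j) (@rshift i j)) //; apply/Kcal_of.
  apply: Kspan_ext (fun u => mulrC _ _) _.
  apply: (Kspan_comp (@lshift_inj _ _)) => // q f g fg; congr (phi _ _).
  rewrite !packf_comp; congr packf; apply: funext => r; apply: fg.
  by rewrite eq_rlshift.
- move=> n F /KcalP[D [phi [Kphi ->]]].
  suff -> : homog_comp n (graded_sum D phi) =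
            WQ_of (if (n < D)%N then phi n else fun=> 0).
    by apply/Kcal_of; case: ifP => // _; apply: Kspan0.
  have E N (w : seq 'I_N) : nccoef (homog_comp n (graded_sum D phi) N) w =
      if size w == n then nccoef (graded_sum D phi N) w else 0.
    rewrite /homog_comp nccoef_sum.
    under eq_bigr => v _ do rewrite nccoefZ nccoef_word.
    case: eqP => [wn|wn].
      subst n; rewrite (bigD1 (in_tuple w)) //= eqxx mulr1 [X in _ + X]big1 ?addr0 //.
      move=> v vw; case: eqP => [e|]; last by rewrite mulr0.
      by case/eqP: vw; apply: val_inj.
    rewrite big1 // => v _; case: eqP => [e|]; last by rewrite mulr0.
    by case: wn; rewrite -e size_tuple.
  apply: WQ_of_ext.
    by apply/homogP => N w /negbTE wn; rewrite E wn.
  move=> N w; rewrite E size_tuple eqxx nccoef_graded_sum tfun_in_tuple_size size_tuple.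
  by case: ifP.
- rewrite WQ_P1E; apply/Kcal_of; exact: (@Kspan_indep _ _ ord0).
- move=> n s F KF hF; have [WF _] := KF; have [phi FE] := WQSym_homog WF hF.
  move: KF; rewrite FE pos_act_WQ_of => /Kcal_of Kphi; apply/Kcal_of.
  exact: Kspan_pos_act.
Qed.

Lemma Kcal_smallest (J : set (ncseq K a_alph)) : WQ_sym_ideal J -> Kcal K `<=` J.
Proof.
move=> IJ F; have [_ J0 Jlin Jl _ _ J1 Ja] := IJ.
case: Kcal_direct_sum => -> _ [N [u [uK ->]]]; rewrite big_nat.
elim/big_rec: _ => [//|k x kN Jx]; rewrite -[u k]scale1r; apply: (Jlin _ _ _ _ Jx).
case: k kN => // k kN; case: (uK _ kN) => m [c [y [yP ->]]].
elim/big_rec: _ => [//|i z _ Jz]; apply: (Jlin _ _ _ _ Jz).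
have [G [s [[WG hG] ->]]] := yP i; apply: Ja; first by apply: Jl.
by rewrite -addn1; apply: homogM => //; rewrite WQ_P1E; apply: homog_WQ_of.
Qed.

End Ideal.

(** * The image and the dimensions *)

Section Image.
Variable K : numFieldType.

Lemma ncsubst_lin (I J : finType) (L : I -> ncpoly K J) c p q : linear_subst L ->
  ncsubst L (c *: p + q) = c *: ncsubst L p + ncsubst L q.
Proof.
move=> linL; apply: nccoefP => w; rewrite nccoefD nccoefZ.
have E r := nccoef_subst_linear r (in_tuple w) linL.
apply: etrans (E _) (etrans _ (congr2 (fun a b => c * a + b) (esym (E p)) (esym (E q)))).
rewrite mulr_sumr -big_split /=; apply: eq_bigr => v _.
by rewrite nccoefD nccoefZ mulrDl mulrA.
Qed.

Lemma SolNC'_lin c (h g : ncseq K bd_alph) : SolNC' K h -> SolNC' K g ->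
  SolNC' K (c *: h + g).
Proof.
move=> [[[D hD] hst] hsol] [[[D' gD] gst] gsol]; split.
  split.
    exists (maxn D D') => n w; rewrite leq_max -mcoeff_neq0 => cw.
    have [/hD -> //|hw] := boolP (w \in msupp (h n)).
    have [/gD ->|gw] := boolP (w \in msupp (g n)); first by rewrite orbT.
    case/negP: cw; rewrite -[(c *: h + g) n]/(c *: h n + g n) mcoeffD mcoeffZ.
    by rewrite (mcoeff_outdom hw) (mcoeff_outdom gw) mulr0 addr0.
  move=> n; apply: etrans (ncsubst_lin c _ _ (@linear_bd_restrict K n)) _.
  by rewrite hst gst.
move=> m i; have [h1 h2] := hsol m i; have [g1 g2] := gsol m i; split.
  apply: etrans (ncsubst_lin c _ _ (@linear_kill_d K _ i)) _.
  apply: etrans _ (esym (ncsubst_lin c _ _ (@linear_merge_b K _ i))).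
  by rewrite h1 g1.
apply: etrans (ncsubst_lin c _ _ (@linear_kill_b K _ i)) _.
apply: etrans _ (esym (ncsubst_lin c _ _ (@linear_merge_d K _ i))).
by rewrite h2 g2.
Qed.

Lemma homog_lin (I : nat -> choiceType) n c (F G : ncseq K I) :
  homog n F -> homog n G -> homog n (c *: F + G).
Proof.
move=> /homogP hF /homogP hG; apply/homogP => N w wn.
by rewrite nccoef_seqP hF // hG // mulr0 addr0.
Qed.

Lemma full_coef_lin n (u : packing n) c (h g : ncseq K bd_alph) :
  full_coef u (c *: h + g) = c * full_coef u h + full_coef u g.
Proof.
rewrite /full_coef /word_coef mulr_sumr -big_split /=; apply: eq_bigr => y _.
exact: nccoef_seqP.
Qed.

Lemma Phi_imageP n H : (Phi_image K `&` homog n) H <->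
  exists phi : packing n -> K, H = Phi (evalA (WQ_of phi)).
Proof.
split=> [[[F /WQSym_graded[D0 [phi FE]] <-] hH]|[phi ->]]; last first.
  split; last exact: homog_Phi_of.
  by exists (WQ_of phi) => //; apply: WQSym_of.
have nD := leq_maxr D0 n.+1; exists (phi n).
have E := etrans (congr1 (fun G => Phi (evalA G)) (FE _ (leq_maxl D0 n.+1)))
  (PhiA_graded _ _).
apply: (etrans E (sum_homog_comp (H := fun k => Phi (evalA (WQ_of (phi k))))
  (fun k => @homog_Phi_of K k (phi k)) nD _)).
exact: eq_ind _ (@homog K bd_alph n) hH _ E.
Qed.

Lemma sub_fullM n k (A : 'M[K]_(k, _)) : (A <= fullM K n)%MS.
Proof. by apply: submx_full; rewrite /row_full (fullM_rank K n).1. Qed.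

(** [fullM] has full column rank, so some Phi(F(A)) has the same full coefficients as [h]; the
    difference is a solution without full coefficients, hence zero. *)
Lemma Sol_Phi n (h : ncseq K bd_alph) : SolNC' K h -> homog n h ->
  exists phi : packing n -> K, h = Phi (evalA (WQ_of phi)).
Proof.
move=> Sh hh; pose x := vec (fun v : even_packing n => full_coef (val v) h).
have /submxP[y yE] := sub_fullM x.
exists (unvec y); set P := Phi _.
suff e : -1 *: P + h = 0.
  by apply/eqP; rewrite eq_sym -subr_eq0 -oppr_eq0 opprB addrC -scaleN1r e.
apply: (@SolNC'_full_coef K n).
- by apply: SolNC'_lin Sh; apply: Phi_of_sol.
- by apply: homog_lin => //; apply: homog_Phi_of.
move=> u ou; rewrite full_coef_lin (full_coef_Phi _ (exist _ u ou)).
move: yE; rewrite mul_vec_fmx => /rowP/(_ (enum_rank (exist _ u ou : even_packing n))).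
by rewrite !mxE enum_rankK /= => ->; rewrite mulN1r addNr.
Qed.

Lemma Phi_image_Sol n : Phi_image K `&` homog n = SolNC' K `&` homog n.
Proof.
apply/seteqP; split=> H.
  by move=> /Phi_imageP[phi ->]; split; [apply: Phi_of_sol | apply: homog_Phi_of].
by move=> [SH hH]; apply/Phi_imageP; apply: Sol_Phi.
Qed.

Lemma WQ_of_unvec_lin n c (x y : 'rV[K]_#|{: packing n}|) :
  WQ_of (unvec (c *: x + y)) = c *: WQ_of (unvec x) + WQ_of (unvec y).
Proof.
rewrite WQ_of_lin; congr WQ_of; apply: funext => u.
by rewrite /unvec !mxE.
Qed.

Lemma has_dim_Kcal n : has_dim (Kcal K `&` homog n) (num_set_compositions n true).
Proof.
have -> : num_set_compositions n true = \rank (kermx (fullM K n)).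
  by rewrite mxrank_ker (fullM_rank K n).1 card_packing card_even_packing addKn.
apply: (@has_dim_image _ _ _ _ (row_base (kermx (fullM K n))) (fun x => WQ_of (unvec x))).
- exact: row_base_free.
- exact: WQ_of_unvec_lin.
- move=> x x0; rewrite -[x]unvecK; apply/vec_eq0.
  apply: (@WQ_of_inj K n _ (fun=> 0)); rewrite x0 /WQ_of big1 // => u _.
  by rewrite scale0r.
move=> v; split=> [[Kv hv]|[x]].
  have [Wv _] := Kv; have [phi vE] := WQSym_homog Wv hv.
  have e : unvec (vec phi) = phi by apply: funext; apply: vecK.
  exists (vec phi); last by rewrite e.
  rewrite eq_row_base; apply/sub_kermxP/fullM_eq0; rewrite e -vE.
  by case: Kv.
rewrite eq_row_base => /sub_kermxP/fullM_eq0 P0 ->.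
by split; [split=> //; apply: WQSym_of | apply: homog_WQ_of].
Qed.

Lemma has_dim_Phi_image n :
  has_dim (Phi_image K `&` homog n) (num_set_compositions n false).
Proof.
rewrite -card_even_packing.
(* [pinvmx] selects an [F] with prescribed full coefficients [x], so [f] recovers an element of the
   image from its full coefficients. *)
pose f (x : 'rV[K]_#|{: even_packing n}|) :=
  Phi (evalA (WQ_of (unvec (x *m pinvmx (fullM K n))))).
have flin c x y : f (c *: x + y) = c *: f x + f y.
  rewrite /f mulmxDl -scalemxAl WQ_of_unvec_lin.
  by apply: PhiA_lin; apply: WQSym_of.
have pK k (x : 'M[K]_(k, _)) : x *m pinvmx (fullM K n) *m fullM K n = x.
  by rewrite mulmxKpV ?sub_fullM.
apply: (@has_dim_image _ _ _ _ 1%:M f) => //.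
- by rewrite /row_free mxrank1.
- by move=> x /fullM_eq0; rewrite pK.
move=> v; split=> [/Phi_imageP[phi ->]|[x _ ->]]; last first.
  by apply/Phi_imageP; exists (unvec (x *m pinvmx (fullM K n))).
exists (vec phi *m fullM K n); first exact: submx1.
have e : unvec (vec phi) = phi by apply: funext; apply: vecK.
set y := vec phi; rewrite -[in LHS]e -/y /f; set z := _ *m pinvmx _.
(* [y] and the selected [z] have the same full coefficients, so their difference is in the kernel
   and both give the same element of the image. *)
have zy : (-1 *: z + y) *m fullM K n = 0.
  by rewrite mulmxDl -scalemxAl pK scaleN1r addNr.
have E := etrans (esym (etrans (congr1 (fun F => Phi (evalA F)) (WQ_of_unvec_lin (-1) z y))
  (PhiA_lin (-1) (WQSym_of _) (WQSym_of _)))) ((fullM_eq0 _).1 zy).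
by apply/eqP; rewrite -subr_eq0 addrC -scaleN1r in E *; apply/eqP.
Qed.

End Image.

From mathcomp Require Import complex.

Theorem theorem6p17 (R : realType) :
  [/\ direct_sum (Kcal R[i]) (Kcal_deg R[i]),
      forall n, has_dim (Kcal R[i] `&` homog n) (num_set_compositions n true),
      WQ_sym_ideal (Kcal R[i]) &
      forall J : set (ncseq R[i] a_alph), WQ_sym_ideal J -> Kcal R[i] `<=` J]
  /\
  (forall n,
      Phi_image R[i] `&` homog n = SolNC' R[i] `&` homog n /\
      has_dim (Phi_image R[i] `&` homog n) (num_set_compositions n false)).
Proof.
split; last by move=> n; split; [exact: Phi_image_Sol | exact: has_dim_Phi_image].
split.
- exact: Kcal_direct_sum.
- exact: has_dim_Kcal.
- exact: Kcal_ideal.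
- exact: Kcal_smallest.
Qed.
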